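(* Assume $L$ satisfies Assumption (A), and let $u\in H^{s/2}$. Let $\varphi,\psi\in C^\infty(\mathbb R)$ satisfy $0\le\varphi,\psi\le1$, with - $\varphi(x)=1$ for $|x|<1$ and $\varphi(x)=0$ for $|x|>2$, - $\psi(x)=0$ for $|x|<1$ and $\psi(x)=1$ for $|x|>2$. Set $\varphi_r(x)=\varphi(x/r)$ and $\psi_r(x)=\psi(x/r)$. Then $$\int_{\mathbb R}\varphi_ru\big(L(\varphi_ru)-\varphi_rLu\big)\,dx\to0 \quad\text{and}\quad \int_{\mathbb R}\psi_ru\big(L(\psi_ru)-\psi_rLu\big)\,dx\to0$$ as $r\to\infty$.
   Context: Fourier transform: $\hat u(\xi)=\int e^{-2\pi ix\xi}u(x)\,dx$. Assumption (A): $s>0$ and $L$ is the Fourier multiplier $\widehat{Lu}=m\hat u$. The symbol $m:\mathbb R\to\mathbb R$ is piecewise continuous with finitely many discontinuities, and there are constants $A_1,A_2>0$ with $A_1|\xi|^s\le m(\xi)\le A_2|\xi|^s$ for $|\xi|\ge1$ and $0\le m(\xi)\le A_2$ for $|\xi|\le1$. For $u,v\in H^{s/2}$ the pairing $\int vLu$ is understood as $\int \overline{\hat v}\,m\,\hat u\,d\xi$ (duality between $H^{s/2}$ and $H^{-s/2}$). *)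

(* Defs.v *)
From HB Require Import structures.
From mathcomp Require Import all_boot all_order all_algebra.
From mathcomp Require Import all_classical all_reals all_analysis.
Set Implicit Arguments. Unset Strict Implicit. Unset Printing Implicit Defensive.
Import Order.TTheory GRing.Theory Num.Theory.
Import numFieldNormedType.Exports.
Local Open Scope classical_set_scope.
Local Open Scope ring_scope.

(* Complex numbers are represented as pairs (real part, imaginary part). *)
Section Defs.
Variable R : realType.

Definition cmul (a b : R * R) : R * R :=
  (a.1 * b.1 - a.2 * b.2, a.1 * b.2 + a.2 * b.1).
Definition cconj (a : R * R) : R * R := (a.1, - a.2).
Definition csub (a b : R * R) : R * R := (a.1 - b.1, a.2 - b.2).
Definition cscale (t : R) (a : R * R) : R * R := (t * a.1, t * a.2).
Definition cnorm2 (a : R * R) : R := a.1 ^+ 2 + a.2 ^+ 2.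

Definition cint (D : set R) (f : R -> R * R) : R * R :=
  (Rintegral (@lebesgue_measure R) D (fun x => (f x).1),
   Rintegral (@lebesgue_measure R) D (fun x => (f x).2)).

Definition L2 (f : R -> R * R) : Prop :=
  measurable_fun setT (fun x => (f x).1) /\
  measurable_fun setT (fun x => (f x).2) /\
  (@lebesgue_measure R).-integrable setT (fun x => (cnorm2 (f x))%:E).

(* kern a b x = \int_a^b exp(-2 pi i x xi) d xi *)
Definition kern (a b : R) (x : R) : R * R :=
  if x == 0 then (b - a, 0)
  else ((sin (2 * pi * x * b) - sin (2 * pi * x * a)) / (2 * pi * x),
        (cos (2 * pi * x * b) - cos (2 * pi * x * a)) / (2 * pi * x)).

(* U is the (L^2 / Plancherel) Fourier transform of u, with the convention
   \hat u(xi) = \int exp(-2 pi i x xi) u(x) dx.  It is characterized by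
   U in L^2 and  \int_a^b U = <u, conj(1_[a,b]^check)>  for all a < b
   (indicators of intervals span a dense subspace of L^2). *)
Definition is_FT (u U : R -> R * R) : Prop :=
  L2 U /\
  forall a b : R, a < b ->
    cint `[a, b] U = cint setT (fun x => cmul (u x) (kern a b x)).

Definition in_H (s : R) (u : R -> R * R) : Prop :=
  L2 u /\ exists U, is_FT u U /\
    (@lebesgue_measure R).-integrable setT
      (fun xi => ((1 + xi ^+ 2) `^ (s / 2) * cnorm2 (U xi))%:E).

Definition piecewise_continuous (m : R -> R) : Prop :=
  exists D : seq R,
    (forall x, x \notin D -> {for x, continuous m}) /\
    (forall x, x \in D -> cvg (m @ x^'+) /\ cvg (m @ x^'-)).

Definition assumptionA (s : R) (m : R -> R) : Prop :=
  0 < s /\ piecewise_continuous m /\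
  exists A1 A2 : R, 0 < A1 /\ 0 < A2 /\
    (forall xi, 1 <= `|xi| ->
        A1 * `|xi| `^ s <= m xi /\ m xi <= A2 * `|xi| `^ s) /\
    (forall xi, `|xi| <= 1 -> 0 <= m xi /\ m xi <= A2).

Definition smooth (f : R -> R) : Prop :=
  forall (n : nat) (x : R), derivable (derive1n n f) x 1.

(* Pairing \int v L w := \int conj(\hat v) m \hat w, given V = \hat v, W = \hat w *)
Definition pairing (m : R -> R) (V W : R -> R * R) : R * R :=
  cint setT (fun xi => cmul (cconj (V xi)) (cscale (m xi) (W xi))).

Definition rmulf (chi : R -> R) (u : R -> R * R) : R -> R * R :=
  fun x => cscale (chi x) (u x).

End Defs.

(* Main.v *)
(** Let [chi] be a smooth cut-off with [chi 0 = 1], equal to [phi], [phi^2],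
    [1 - psi] or [1 - psi^2], and write [chi] as a superposition of characters,
    [chi x = \int k(eta) exp(-2 pi i x eta) d eta], where [k] decays faster than
    any power.  Then the Fourier transform of [chi (x / r) u] is the average
    [\int k(eta) U(xi + eta / r) d eta] of translates of [U].  Translations are
    continuous in [L^2] with the weight [(1 + xi^2)^(s/2)] and have norm
    [O((1 + h^2)^(s/4))] there, so these averages converge to
    [(\int k) U = U] in the weighted space by Cauchy-Schwarz and dominated
    convergence.  Since [0 <= m <= A (1 + xi^2)^(s/2)], the pairing is
    continuous on the weighted space: the two pairings of the statement tend
    to the same limit, [\int m |U|^2] for [phi] and [0] for [psi].

    The inversion formula for [chi] is obtained by Abel summation: the damping
    [exp(-e |eta|)] turns the double integral into a Poisson integral of [chi]. *)

Require Import Defs.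
From HB Require Import structures.
From mathcomp Require Import all_boot all_order all_algebra.
From mathcomp Require Import all_classical all_reals all_analysis.
From mathcomp Require Import measurable_realfun ring lra.
Import Order.TTheory GRing.Theory Num.Theory.
Import numFieldNormedType.Exports.
Local Open Scope classical_set_scope.
Local Open Scope ring_scope.

(** As [u] is only square integrable, its transform is known through integrals over intervals and
    not pointwise. The averaging formula for the transform of [chi (x / r) u] is therefore proved
    weakly: both sides are integrated over [[a, b]]; translating the interval by [h] multiplies
    [kern a b] by [exp(-2 pi i x h)]; Fubini brings the inversion integral of [chi] inside the
    integral in [x]; and Lebesgue differentiation turns equality on all intervals into equality
    almost everywhere. The same device gives uniqueness of the transform, which is needed because
    [in_H] only provides some transform of finite weighted norm.

    Squares of the cut-offs occur because [phi_r] is real: the integral of [phi_r u] against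
    [phi_r L u] is the pairing of [phi_r^2 u] with [u].

    Complex numbers being pairs, [k] is handled through its real part [ftrig cos chi] and its
    imaginary part [ftrig sin chi], of masses [1] and [0]. Norms are kept squared and extended-real;
    factors of 2 and Young's inequality with a free parameter replace square roots. *)

(** * Translations, and almost everywhere equality from integrals over intervals *)

Section translation.
Context {R : realType}.
Notation mu := (@lebesgue_measure R).

Lemma measurable_addr (h : R) : measurable_fun setT (fun x : R => x + h).
Proof. exact: measurable_funD. Qed.

(** Lebesgue measure is determined by its values on intervals []a, b]], and the preimage of such an
    interval is []a - h, b - h]], of the same length. *)
Lemma pushforward_addr (h : R) (A : set R) : measurable A ->
  pushforward mu (fun x : R => x + h : measurableTypeR R) A = mu A.
Proof.
move=> mA; apply/esym; apply: lebesgue_measure_unique => //=.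
  exact: measurable_addr.
move=> mh _ [[a b]] _ <-.
rewrite /pushforward.
rewrite (_ : _ @^-1` _ = `]a - h, b - h]%classic); last first.
  by apply/seteqP; split => x /=; rewrite !in_itv/= ltrBlDr lerBrDr.
rewrite !lebesgue_measure_itv/= !lte_fin ltrD2r.
by congr (if _ then _ else _); congr EFin; lra.
Qed.

Lemma ge0_integral_addr (h : R) (f : R -> \bar R) :
  measurable_fun setT f -> (forall x, 0 <= f x)%E ->
  (\int[mu]_x f (x + h)%R = \int[mu]_x f x)%E.
Proof.
move=> mf f0.
pose phi (x : R) : measurableTypeR R := x + h.
transitivity (\int[pushforward mu phi]_x f x)%E.
  rewrite ge0_integral_pushforward//; exact: measurable_addr.
apply: eq_measure_integral => //= [|? A mA _]; first exact: measurable_addr.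
exact: pushforward_addr.
Qed.

Lemma integral_addr (h : R) (f : R -> \bar R) :
  measurable_fun setT f ->
  (\int[mu]_x f (x + h)%R = \int[mu]_x f x)%E.
Proof.
move=> mf; rewrite integralE [RHS]integralE; congr (_ - _)%E.
  rewrite -(ge0_integral_addr h _ (measurable_funepos mf))//.
  by apply: eq_integral => x _; rewrite !funeposE.
rewrite -(ge0_integral_addr h _ (measurable_funeneg mf))//.
by apply: eq_integral => x _; rewrite !funenegE.
Qed.

Lemma ae_impl (P Q : R -> Prop) : (forall x, P x -> Q x) ->
  {ae mu, forall x, P x} -> {ae mu, forall x, Q x}.
Proof. by move=> PQ; apply: negligibleS => x /= + Px; apply; exact: PQ. Qed.

(** The indefinite integral of [f - g] vanishes identically, while by Lebesgue differentiation its
    derivative is [f - g] almost everywhere. This is the uniqueness principle behind [is_FT], which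
    only prescribes integrals over intervals. *)
Lemma eq_itv_integral_ae (f g : R -> R) :
  (forall a b, mu.-integrable `[a, b] (EFin \o f)) ->
  (forall a b, mu.-integrable `[a, b] (EFin \o g)) ->
  measurable_fun setT f -> measurable_fun setT g ->
  (forall a b, a < b -> \int[mu]_(x in `[a, b]) f x = \int[mu]_(x in `[a, b]) g x) ->
  {ae mu, forall x, f x = g x}.
Proof.
move=> fi gi mf mg fg.
pose h x := f x - g x.
have hi a b : mu.-integrable `[a, b] (EFin \o h).
  rewrite (_ : EFin \o h = (EFin \o f) \- (EFin \o g))%E; last exact/funext.
  exact: integrableB.
have h0 a x : \int[mu]_(t in `[a, x]) h t = 0.
  have [ax|xa|->] := ltgtP a x; last 2 first.
  - by rewrite set_itv_ge ?Rintegral_set0// -leNgt/= bnd_simp.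
  - by rewrite set_itv1 Rintegral_set1.
  by rewrite RintegralB// fg// subrr.
have mh : measurable_fun setT h by exact: measurable_funB.
have lh : locally_integrable setT h.
  split => //; first exact: openT.
  move=> K _ cK; have /= := compact_bounded cK.
  move=> [M [_ /(_ (`|M| + 1))]].
  rewrite (le_lt_trans (ler_norm _)) ?ltrDl// => /(_ isT) KM.
  have /integrableP[_] := hi (- (`|M| + 1)) (`|M| + 1).
  apply: le_lt_trans => /=; apply: ge0_subset_integral => //.
  - exact: compact_measurable.
  - by apply/measurable_EFinP/measurableT_comp => //; exact: measurable_funS mh.
  - by move=> x /KM /=; rewrite in_itv/= -ler_norml.
(* [FTC1] covers the points to the right of a base point; the rays starting at [- n] exhaust the
   line, and a countable union of null sets is null. *)
have H (n : nat) : {ae mu, forall x, - n%:R < x -> f x = g x}.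
  have := @FTC1 R h (BLeft (- n%:R)) (fun y => hi (- n%:R) y) lh.
  apply: filterS; first exact: (ae_filter_ringOfSetsType mu).
  move=> x /= + nx; rewrite lte_fin => /(_ nx)[_].
  rewrite (_ : (fun x => _) = cst 0); last by apply/funext => y; exact: h0.
  by rewrite derive1_cst /h => /eqP; rewrite eq_sym subr_eq0 => /eqP.
apply: ae_impl (ae_foralln H) => x /(_ (Num.truncn `|x|).+1); apply.
by rewrite ltrNl (le_lt_trans (ler_norm _))// normrN truncnS_gt.
Qed.

End translation.

(** * Nonnegative integrals with values in the extended reals *)

Section nonneg_integrals.
Context {R : realType}.
Notation mu := (@lebesgue_measure R).
Local Notation mfun f := (measurable_fun (setT : set R) (f : R -> R)).

Definition intR (f : R -> R) : \bar R := (\int[mu]_x (f x)%:E)%E.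

Lemma intR_ge0 (f : R -> R) : (forall x, 0 <= f x) -> (0 <= intR f)%E.
Proof. by move=> f0; apply: integral_ge0 => x _; rewrite lee_fin. Qed.

Lemma eq_intR (f g : R -> R) : f =1 g -> intR f = intR g.
Proof. by move=> fg; congr intR; exact/funext. Qed.

Lemma le_intR (f g : R -> R) : mfun f -> mfun g ->
  (forall x, 0 <= f x) -> (forall x, f x <= g x) -> (intR f <= intR g)%E.
Proof.
move=> mf mg f0 fg; apply: ge0_le_integral => //;
  do ?[exact/measurable_EFinP]; move=> x _; rewrite lee_fin//.
Qed.

Lemma intRD (f g : R -> R) : mfun f -> mfun g ->
  (forall x, 0 <= f x) -> (forall x, 0 <= g x) ->
  intR (fun x => f x + g x) = (intR f + intR g)%E.
Proof.
move=> mf mg f0 g0; rewrite /intR; under eq_integral do rewrite EFinD.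
by rewrite ge0_integralD//; do ?[exact/measurable_EFinP];
  move=> x _; rewrite lee_fin.
Qed.

Lemma intRZ (c : R) (f : R -> R) : 0 <= c -> mfun f ->
  (forall x, 0 <= f x) -> intR (fun x => c * f x) = (c%:E * intR f)%E.
Proof.
move=> c0 mf f0; rewrite /intR; under eq_integral do rewrite EFinM.
rewrite ge0_integralZl//; first exact/measurable_EFinP.
by move=> x _; rewrite lee_fin.
Qed.

Lemma integrable_intR (f : R -> R) : mfun f -> (forall x, 0 <= f x) ->
  (intR f < +oo)%E -> mu.-integrable setT (EFin \o f).
Proof.
move=> mf f0 fi; apply/integrableP; split; first exact/measurable_EFinP.
apply: le_lt_trans fi; rewrite le_eqVlt; apply/orP; left; apply/eqP.
by apply: eq_integral => x _ /=; rewrite ger0_norm.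
Qed.

Lemma intR_integrable (f : R -> R) : mu.-integrable setT (EFin \o f) ->
  (intR (fun x => `|f x|)%R < +oo)%E.
Proof. by move=> /integrableP[]. Qed.

Lemma cvge0P (a : nat -> \bar R) : (forall n, 0 <= a n)%E ->
  (a @ \oo --> 0%E) <-> (forall e, 0 < e -> \forall n \near \oo, (a n <= e%:E)%E).
Proof.
move=> a0; split.
  move=> /fine_cvgP[afin /cvgrPdist_le acvg] e e0.
  have := acvg _ e0.
  apply: filterS2 afin => n fa; rewrite sub0r normrN/= => fe.
  by rewrite -(fineK fa) lee_fin (le_trans _ fe)// ler_norm.
move=> H; apply/fine_cvgP; split.
  apply: filterS (H 1 ltr01) => n an.
  by rewrite ge0_fin_numE// (le_lt_trans an)// ltry.
apply/cvgrPdist_le => e e0; apply: filterS (H _ e0) => n an /=.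
rewrite sub0r normrN ger0_norm ?fine_ge0//.
by rewrite -lee_fin fineK// ge0_fin_numE// (le_lt_trans an)// ltry.
Qed.

(** Domination is asked only for large [n], because the bounds to come rely on [|h n| <= 1] for a
    sequence [h] tending to [0]. Dropping the first [N] terms restores the usual hypotheses. *)
Lemma dominated_intR0 (f : nat -> R -> R) (g : R -> R) :
  (forall n, mfun (f n)) -> mfun g -> (intR g < +oo)%E ->
  (forall n x, 0 <= f n x) ->
  (\forall n \near \oo, forall x, f n x <= g x) ->
  {ae mu, forall x, f n x @[n --> \oo] --> (0:R)} ->
  intR (f n) @[n --> \oo] --> 0%E.
Proof.
move=> mf mg gi f0 [N _ fg] fcvg.
rewrite -(cvg_shiftn N).
have g0 x : 0 <= g x by rewrite (le_trans (f0 N x))// fg/=.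
have [] := @dominated_convergence _ _ R mu setT measurableT
  (fun n x => (f (n + N)%N x)%:E) (cst 0%E) (EFin \o g).
- by move=> n; apply/measurable_EFinP; exact: mf.
- exact: measurable_cst.
- apply: ae_impl fcvg => x fx _ /=; apply: cvg_EFin; first exact: nearW.
  by rewrite /comp/= (cvg_shiftn N (f ^~ x)).
- exact: integrable_intR.
- apply: aeW => x n _ /=; rewrite lee_fin ger0_norm// fg//=.
  by rewrite leq_addl.
- by move=> _ _; rewrite integral0.
Qed.

End nonneg_integrals.

(** * The weighted norm *)

Section weighted_norm.
Context {R : realType}.
Notation mu := (@lebesgue_measure R).
Local Notation mfun f := (measurable_fun (setT : set R) (f : R -> R)).

Definition wt (s x : R) : R := (1 + x ^+ 2) `^ (s / 2).

Lemma wt_ge0 s x : 0 <= wt s x. Proof. exact: powR_ge0. Qed.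

Lemma onePsqr_gt0 (x : R) : 0 < 1 + x ^+ 2.
Proof. by rewrite ltr_wpDr// sqr_ge0. Qed.

Lemma wt_ge1 s x : 0 <= s -> 1 <= wt s x.
Proof.
move=> s0; rewrite -(powRr0 (1 + x ^+ 2)); apply: ler_powR.
  by rewrite lerDl sqr_ge0.
by rewrite divr_ge0.
Qed.

Lemma wt_homo s x y : 0 <= s -> `|x| <= `|y| -> wt s x <= wt s y.
Proof.
move=> s0 xy; apply: ge0_ler_powR.
- by rewrite divr_ge0.
- by rewrite nnegrE ltW// onePsqr_gt0.
- by rewrite nnegrE ltW// onePsqr_gt0.
- by rewrite lerD2l -real_normK ?num_real// -(real_normK (num_real y)) lerXn2r ?nnegrE.
Qed.

(** Peetre's inequality: [2 (1 + x^2) (1 + h^2) - (1 + (x + h)^2)] equals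
    [1 + (x - h)^2 + 2 (x h)^2], and the power [s / 2] is monotone. *)
Lemma wtD s x h : 0 <= s -> wt s (x + h) <= 2 `^ (s / 2) * wt s x * wt s h.
Proof.
move=> s0; rewrite /wt.
have x0 := onePsqr_gt0 x; have h0 := onePsqr_gt0 h.
rewrite (_ : _ * _ * _ = (2 * (1 + x ^+ 2) * (1 + h ^+ 2)) `^ (s / 2)); last first.
  by rewrite powRM ?mulr_ge0 ?(ltW x0) ?(ltW h0)// powRM ?(ltW x0).
apply: ge0_ler_powR.
- by rewrite divr_ge0.
- by rewrite nnegrE ltW// onePsqr_gt0.
- by rewrite nnegrE !mulr_ge0// ltW// onePsqr_gt0.
- have := sqr_ge0 (x - h); have := sqr_ge0 (x * h); nra.
Qed.

Lemma measurable_wt s : mfun (wt s).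
Proof.
apply: (measurableT_comp (measurable_powR _)).
exact: measurable_funD.
Qed.

(** The square of the norm, in [\bar R]; applied to the two components of a transform and summed, it
    gives the square of the [H^(s/2)] norm. *)
Definition normW (s : R) (f : R -> R) : \bar R :=
  intR (fun x => wt s x * f x ^+ 2).

Lemma wsqr_ge0 s (f : R -> R) x : 0 <= wt s x * f x ^+ 2.
Proof. by rewrite mulr_ge0 ?wt_ge0 ?sqr_ge0. Qed.

Lemma measurable_wsqr s (f : R -> R) : mfun f -> mfun (fun x => wt s x * f x ^+ 2).
Proof.
by move=> mf; apply: measurable_funM; [exact: measurable_wt|exact: measurable_funX].
Qed.

Lemma normW_ge0 s f : (0 <= normW s f)%E.
Proof. by apply: intR_ge0 => x; exact: wsqr_ge0. Qed.

Lemma eq_normW s f g : f =1 g -> normW s f = normW s g.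
Proof. by move=> fg; apply: eq_intR => x; rewrite fg. Qed.

Lemma normWN s f : normW s (fun x => - f x) = normW s f.
Proof. by apply: eq_intR => x; rewrite sqrrN. Qed.

(** Under the integral the two sides differ by [wt s x (f x - g x)^2]. This stands in for the
    triangle inequality, at the price of a factor 2 per use. *)
Lemma le_normWD s f g : mfun f -> mfun g ->
  (normW s (fun x => f x + g x)%R <= 2%:E * normW s f + 2%:E * normW s g)%E.
Proof.
move=> mf mg.
have mf2 := measurable_wsqr s f mf; have mg2 := measurable_wsqr s g mg.
have f0 := wsqr_ge0 s f; have g0 := wsqr_ge0 s g.
rewrite /normW -!intRZ// -intRD//; last 4 first.
- exact: measurable_funM.
- exact: measurable_funM.
- by move=> x; rewrite mulr_ge0.
- by move=> x; rewrite mulr_ge0.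
apply: le_intR.
- by apply: measurable_wsqr; exact: measurable_funD.
- by apply: measurable_funD; exact: measurable_funM.
- by move=> x; exact: (wsqr_ge0 s (fun x => f x + g x)).
move=> x; rewrite -subr_ge0.
rewrite (_ : _ - _ = wt s x * (f x - g x) ^+ 2); last by ring.
by rewrite mulr_ge0 ?wt_ge0 ?sqr_ge0.
Qed.

Lemma le_normWD_fin s f g (a b : R) : mfun f -> mfun g ->
  (normW s f <= a%:E)%E -> (normW s g <= b%:E)%E ->
  (normW s (fun x => f x + g x)%R <= (2 * a + 2 * b)%:E)%E.
Proof.
move=> mf mg fa gb; apply: (le_trans (le_normWD _ _ _ mf mg)).
by rewrite (EFinD (2 * a)) !EFinM; apply: leeD; rewrite lee_wpmul2l.
Qed.

Lemma measurable_shift (f : R -> R) h : mfun f -> mfun (fun x => f (x + h)).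
Proof. by move=> mf; apply: (measurableT_comp mf); exact: measurable_addr. Qed.

(** Translate the integral that defines [normW s f], then compare the weights at [x] and [x + h] by
    Peetre's inequality for [x = (x + h) - h]. *)
Lemma normW_shift s f h : 0 <= s -> mfun f ->
  (normW s (fun x => f (x + h))%R <= (2 `^ (s / 2) * wt s h)%:E * normW s f)%E.
Proof.
move=> s0 mf.
have -> : normW s f = intR (fun x => wt s (x + h) * f (x + h) ^+ 2).
  rewrite /normW /intR -[LHS](ge0_integral_addr h)//.
    by apply/measurable_EFinP; exact: measurable_wsqr.
  by move=> x; rewrite lee_fin wsqr_ge0.
have m1 : mfun (fun x => wt s (x + h) * f (x + h) ^+ 2).
  exact: (measurable_shift _ h (measurable_wsqr s f mf)).
rewrite -intRZ//.
- apply: le_intR.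
  + by apply: measurable_wsqr; exact: measurable_shift.
  + exact: measurable_funM.
  + by move=> x; rewrite mulr_ge0 ?wt_ge0 ?sqr_ge0.
  move=> x; rewrite mulrA ler_wpM2r ?sqr_ge0//.
  have := wtD s (x + h) (- h) s0; rewrite addrK => /le_trans; apply.
  by rewrite /wt sqrrN mulrAC.
- by rewrite mulr_ge0 ?powR_ge0 ?wt_ge0.
- by move=> x; rewrite mulr_ge0 ?wt_ge0 ?sqr_ge0.
Qed.

(** The growth in [h] is explicit because [C * wt s h] will dominate an integral over all
    translations; the constant term is absorbed by [1 <= wt s h]. *)
Lemma normW_diff_bound s f : 0 <= s -> mfun f -> (normW s f < +oo)%E ->
  exists2 C, 0 <= C &
    forall h, (normW s (fun x => f (x + h) - f x)%R <= (C * wt s h)%:E)%E.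
Proof.
move=> s0 mf ff.
have fN : normW s f \is a fin_num by rewrite ge0_fin_numE// normW_ge0.
have F0 : 0 <= fine (normW s f) by rewrite fine_ge0// normW_ge0.
exists (2 * (2 `^ (s / 2) * fine (normW s f)) + 2 * fine (normW s f)).
  by rewrite addr_ge0 ?mulr_ge0// powR_ge0.
move=> h.
apply: (le_trans (le_normWD_fin s (fun x => f (x + h)) (fun x => - f x)
  (2 `^ (s / 2) * wt s h * fine (normW s f)) (fine (normW s f)) _ _ _ _)).
- exact: measurable_shift.
- exact: measurableT_comp.
- by rewrite EFinM fineK// normW_shift.
- by rewrite normWN fineK.
rewrite lee_fin -subr_ge0.
rewrite (_ : _ - _ = 2 * fine (normW s f) * (wt s h - 1)); last by ring.
by rewrite !mulr_ge0// subr_ge0 wt_ge1.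
Qed.

Definition clip (M y : R) : R := Num.max (- M) (Num.min M y).

Lemma norm_clip M y : 0 <= M -> `|clip M y| <= M.
Proof.
move=> M0; rewrite /clip ler_norml le_max lexx/= ge_max ge_min lexx/= andbT.
by rewrite ge0_cp//.
Qed.

(** Clipping is the projection onto [[- M, M]], hence brings [y] no farther from a point [z] of that
    interval. *)
Lemma clip_dist M y z : `|z| <= M -> `|z - clip M y| <= `|z - y|.
Proof.
rewrite ler_norml => /andP[z1 z2]; rewrite /clip minEle.
case: (leP M y) => My; rewrite maxEle; case: (leP (- M)) => h //; last 2 first.
- by lra.
- by rewrite !ger0_norm; lra.
- by rewrite !ler0_norm; lra.
Qed.

Lemma continuous_clip M : continuous (clip M).
Proof.
move=> y; apply: (@continuous_max _ _ (fun=> - M) (fun z => Num.min M z)).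
  exact: cvg_cst.
by apply: (@continuous_min _ _ (fun=> M) id); [exact: cvg_cst|exact: cvg_id].
Qed.

End weighted_norm.

(** * Continuity of translations in the weighted norm *)

Section translation_continuity.
Context {R : realType}.
Notation mu := (@lebesgue_measure R).
Local Notation mfun f := (measurable_fun (setT : set R) (f : R -> R)).

Definition translation_cvg s (f : R -> R) := forall h : nat -> R, h n @[n --> \oo] --> (0:R) ->
  normW s (fun x => f (x + h n) - f x) @[n --> \oo] --> 0%E.

Definition cutf (M : R) (f : R -> R) x :=
  if (`|x| <= M) && (`|f x| <= M) then f x else 0.

(** The approximant of [cutf M f]: a continuous [g], clipped so that it obeys the same bound [M] on
    the same interval. It jumps only at the two ends of the interval. *)
Definition clipf (M : R) (g : R -> R) x := if `|x| <= M then clip M (g x) else 0.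

Lemma measurable_norm_le (f : R -> R) M : mfun f ->
  measurable_fun (setT : set R) (fun x => `|f x| <= M).
Proof.
by move=> mf; apply: measurable_fun_ler => //; exact: measurableT_comp.
Qed.

Lemma measurable_cutf M f : mfun f -> mfun (cutf M f).
Proof.
move=> mf; apply: measurable_fun_ifT => //.
apply: measurable_and; first exact: (@measurable_norm_le id).
exact: measurable_norm_le.
Qed.

Lemma measurable_clipf M g : mfun g -> mfun (clipf M g).
Proof.
move=> mg; apply: measurable_fun_ifT => //; first exact: (@measurable_norm_le id).
apply: measurableT_comp => //.
by apply: continuous_measurable_fun; exact: continuous_clip.
Qed.

Lemma norm_clipf M g x : 0 <= M -> `|clipf M g x| <= M.
Proof. by move=> M0; rewrite /clipf; case: ifP; rewrite ?normr0// norm_clip. Qed.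

Lemma cutf_cvg s f : mfun f -> (normW s f < +oo)%E ->
  normW s (fun x => f x - cutf n%:R f x) @[n --> \oo] --> 0%E.
Proof.
move=> mf ff; apply: (@dominated_intR0 _ _ (fun x => wt s x * f x ^+ 2)).
- move=> n; apply: measurable_wsqr; apply: measurable_funB => //.
  exact: measurable_cutf.
- exact: measurable_wsqr.
- exact: ff.
- by move=> n x; rewrite mulr_ge0 ?wt_ge0 ?sqr_ge0.
- apply: nearW => n x; rewrite ler_wpM2l ?wt_ge0//.
  by rewrite /cutf; case: ifP; rewrite ?subr0// subrr expr0n/= sqr_ge0.
- apply: aeW => x; apply: cvg_near_cst.
  near=> n; rewrite /cutf ifT ?subrr ?expr0n/= ?mulr0//.
  apply/andP; split; near: n; exact: nbhs_infty_ger.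
Unshelve. all: by end_near. Qed.

(** Dominated convergence: [clipf M g] is bounded with bounded support, and continuous except
    possibly at [M] and [- M]. *)
Lemma clipf_translation_cvg (s M : R) (g : R -> R) : 0 <= s -> 0 <= M -> continuous g ->
  translation_cvg s (clipf M g).
Proof.
move=> s0 M0 cg h h0.
have mg : mfun g by exact: continuous_measurable_fun.
have mc := measurable_clipf M g mg.
(* When [|h n| <= 1], both terms vanish for [|x| > M + 1]; elsewhere they differ by at most [2 M]
   and the weight is at most [wt s (M + 1)]. *)
pose G (x : R) : R := (if `|x| <= M + 1 then 1 else 0) * (wt s (M + 1) * (2 * M) ^+ 2).
apply: (@dominated_intR0 _
  (fun n x => wt s x * (clipf M g (x + h n) - clipf M g x) ^+ 2) G).
- move=> n; apply: measurable_wsqr; apply: measurable_funB => //.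
  exact: measurable_shift.
- apply: measurable_funM => //; apply: measurable_fun_ifT => //.
  exact: (@measurable_norm_le id).
- have GE : G = (fun x => (wt s (M + 1) * (2 * M) ^+ 2) * \1_(`[- (M + 1), M + 1]) x).
    apply/funext => x; rewrite /G mulrC indicE; congr (_ * _).
    by rewrite ler_norml; case: (boolP (_ <= _ <= _)) => hx;
      [rewrite mem_set//= in_itv|rewrite memNset//= in_itv/=; exact/negP].
  rewrite GE intRZ ?mulr_ge0 ?wt_ge0 ?sqr_ge0//.
  rewrite /intR integral_indic//= setIT lebesgue_measure_itv/=.
  by case: ifP => _; rewrite ?mule0// -?EFinB -?EFinM ltry.
- by move=> n x; rewrite mulr_ge0 ?wt_ge0 ?sqr_ge0.
- near=> n => x.
  have hn : `|h n| <= 1.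
    by near: n; move/cvgrPdist_le: h0 => /(_ 1 ltr01); apply: filterS => n;
      rewrite sub0r normrN.
  rewrite /G; case: ifPn => [xM|/negbTE xM].
    rewrite mul1r; apply: ler_pM; rewrite ?wt_ge0 ?sqr_ge0//.
      by apply: wt_homo => //; rewrite (le_trans xM)// ler_norm.
    rewrite -real_normK ?num_real// lerXn2r ?nnegrE ?mulr_ge0//.
    apply: (le_trans (ler_normB _ _)); rewrite mulr_natl mulr2n.
    by apply: lerD; exact: norm_clipf.
  rewrite mul0r /clipf ifF; last first.
    by apply/negP => xhM; move/negbT: xM; rewrite -ltNge => xM;
      have := ler_normB (x + h n) (h n); rewrite addrK; lra.
  rewrite ifF ?subrr ?expr0n/= ?mulr0//.
  by apply/negP => xhM; move/negbT: xM; rewrite -ltNge; lra.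
- have ae0 : {ae mu, forall x, x <> M /\ x <> - M}.
    have N0 : mu.-negligible ([set M] `|` [set - M]).
      by apply: negligibleU; apply/negligibleP => //; exact: lebesgue_measure_set1.
    apply: negligibleS N0 => x /= /not_andP[/contrapT ->|/contrapT ->]; [left|right] => //.
  apply: ae_impl ae0 => x [xM xNM].
  suff H : clipf M g (x + h n) @[n --> \oo] --> clipf M g x.
    have H1 : clipf M g (x + h n) - clipf M g x @[n --> \oo] --> (0:R).
      by rewrite -(subrr (clipf M g x)); apply: cvgB => //; exact: cvg_cst.
    have H2 := cvgM H1 H1; rewrite mulr0 in H2.
    by rewrite -(mulr0 (wt s x)); apply: cvgM; [exact: cvg_cst|exact: H2].
  have xh : x + h n @[n --> \oo] --> x.
    by rewrite -[X in _ --> X]addr0; apply: cvgD => //; exact: cvg_cst.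
  have nxh : `|x + h n| @[n --> \oo] --> `|x| by exact: cvg_norm.
  have nxM : `|x| != M.
    by apply/eqP; have [?|?] := ger0P x => ?; [exact: xM|apply: xNM; lra].
  have [lt|gt|/eqP] := ltgtP `|x| M; last by rewrite (negbTE nxM).
  + rewrite {2}/clipf (ltW lt).
    apply: (@cvg_trans _ (clip M (g (x + h n)) @[n --> \oo])).
      apply: near_eq_cvg; near=> n; rewrite /clipf ifT// ltW//.
      by near: n; exact: (cvgr_lt _ nxh).
    apply: continuous_cvg; first exact: continuous_clip.
    by apply: continuous_cvg => //; exact: cg.
  + rewrite {2}/clipf (lt_geF gt); apply: cvg_near_cst; near=> n.
    rewrite /clipf ifF//; apply/lt_geF.
    by near: n; exact: (cvgr_gt _ nxh).
Unshelve. all: by end_near. Qed.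

(** Density of continuous functions is used in [L^1] of [[- M, M]]. It passes to weighted [L^2]
    because all values are bounded by [M]. *)
Lemma cutf_approx (s M : R) (f : R -> R) (e : R) : 0 <= s -> 0 < M -> mfun f -> 0 < e ->
  exists2 g : R -> R, continuous g &
    (normW s (fun x => cutf M f x - clipf M g x)%R <= e%:E)%E.
Proof.
move=> s0 M0 mf e0.
pose E : set R := `[- M, M]%classic.
have mE : measurable E by exact: measurable_itv.
have muE : (mu E < +oo)%E.
  by rewrite lebesgue_measure_itv/=; case: ifP => _; rewrite ?ltry// -EFinB ltry.
have cutM x : `|cutf M f x| <= M.
  by rewrite /cutf; case: ifP => [/andP[]//|_]; rewrite normr0 ltW.
have iE : mu.-integrable E (EFin \o cutf M f).
  apply: measurable_bounded_integrable => //.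
    by apply: measurable_funTS; exact: measurable_cutf.
  exists M; split; first exact: num_real.
  by move=> y My x _ /=; rewrite (le_trans (cutM x))// ltW.
have [g_ [cg ig gcvg]] := approximation_continuous_integrable mE muE iE.
(* On [[- M, M]] the weight is at most [wt s M], and the square of a difference of two values
   bounded by [M] is at most [2 M] times its modulus. *)
pose K := wt s M * (2 * M).
have K0 : 0 < K by rewrite mulr_gt0 ?mulr_gt0// (lt_le_trans ltr01)// wt_ge1.
have a0 n : (0 <= \int[mu]_(z in E) `|(cutf M f z - g_ n z)%:E|)%E.
  by apply: integral_ge0.
move/(cvge0P _ a0)/(_ (e / K)) : gcvg; rewrite divr_gt0// => /(_ isT).
case => n _ /(_ n (leqnn _)) ge; exists (g_ n); first exact: cg.
have mg : mfun (g_ n) by apply: continuous_measurable_fun.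
have mD : mfun (fun x => cutf M f x - g_ n x).
  by apply: measurable_funB => //; exact: measurable_cutf.
have Ex x : (x \in E) = (`|x| <= M).
  by apply/idP/idP; rewrite inE/= /E/= in_itv/= ler_norml.
have /le_trans : (normW s (fun x => cutf M f x - clipf M (g_ n) x)%R <=
  intR (fun x => K * (\1_E x * `|cutf M f x - g_ n x|))%R)%E.
  apply: le_intR.
  - apply: measurable_wsqr; apply: measurable_funB; first exact: measurable_cutf.
    exact: measurable_clipf.
  - apply: measurable_funM => //; apply: measurable_funM => //.
    exact: measurableT_comp.
  - by move=> x; rewrite mulr_ge0 ?wt_ge0 ?sqr_ge0.
  move=> x; rewrite indicE Ex.
  have [xM|xM] := leP `|x| M; last first.
    by rewrite /cutf /clipf (lt_geF xM)/= subrr expr0n/= mulr0 mul0r mulr0.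
  rewrite mul1r /K -mulrA; apply: ler_pM; rewrite ?wt_ge0 ?sqr_ge0//.
    by apply: wt_homo => //; rewrite (le_trans xM)// ler_norm.
  rewrite -real_normK ?num_real// expr2; apply: ler_pM => //.
    apply: (le_trans (ler_normB _ _)); rewrite mulr_natl mulr2n.
    by apply: lerD => //; apply: norm_clipf; exact: ltW.
  by rewrite /clipf xM; apply: clip_dist.
apply; rewrite intRZ ?(ltW K0)//; last first.
  by apply: measurable_funM => //; exact: measurableT_comp.
have -> : e = K * (e / K) by rewrite mulrC divfK// lt0r_neq0.
rewrite (EFinM K).
rewrite lee_wpmul2l ?lee_fin ?(ltW K0)//.
apply: le_trans ge; rewrite integral_mkcond.
rewrite le_eqVlt; apply/orP; left; apply/eqP; apply: eq_integral => x _.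
by rewrite patchE indicE; case: ifP => _; rewrite ?mul1r ?mul0r.
Qed.

(** Approximate [f] by some [clipf M g], whose translations converge. The translate of the error is
    controlled uniformly for [|h n| <= 1] by [normW_shift]. *)
Lemma translation_cvg_normW s f : 0 <= s -> mfun f -> (normW s f < +oo)%E ->
  translation_cvg s f.
Proof.
move=> s0 mf ff h h0.
apply/cvge0P => [n|e e0]; first exact: normW_ge0.
pose C := 2 `^ (s / 2) * wt s 1.
have C0 : 0 <= C by rewrite mulr_ge0 ?powR_ge0 ?wt_ge0.
(* The translated error ([C * (4 * d)]), the increment of [clipf M g] ([d]) and the error itself
   ([4 * d]) add up, with the factors 2, to [2 (C 4 d) + 2 (2 d + 2 (4 d)) = d (8 C + 20)]. *)
pose d := e / (8 * C + 20).
have d0 : 0 < d by rewrite divr_gt0//; lra.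
have [n0 _ Hn0] := (cvge0P _ (fun n => normW_ge0 s _)).1 (cutf_cvg s f mf ff) d d0.
have := Hn0 n0.+1 (leqnSn _); set M := n0.+1%:R => fM.
have M0 : 0 < M by rewrite /M.
have [g cg gM] := cutf_approx s M f d s0 M0 mf d0.
have mg : mfun (clipf M g) by apply: measurable_clipf; exact: continuous_measurable_fun.
have mc : mfun (cutf M f) by exact: measurable_cutf.
have fg : (normW s (fun x => f x - clipf M g x)%R <= (4 * d)%:E)%E.
  have -> : 4 * d = 2 * d + 2 * d by ring.
  apply: le_trans (le_normWD_fin s _ _ d d _ _ fM gM).
  - by rewrite le_eqVlt; apply/orP; left; apply/eqP/eq_normW => x; ring.
  - exact: measurable_funB.
  - exact: measurable_funB.
have gcvg := (cvge0P _ (fun n => normW_ge0 s _)).1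
  (clipf_translation_cvg s M g s0 (ltW M0) cg h h0) d d0.
near=> n.
have hn : `|h n| <= 1.
  by near: n; move/cvgrPdist_le: h0 => /(_ 1 ltr01); apply: filterS => n;
    rewrite sub0r normrN.
have gn : (normW s (fun x => clipf M g (x + h n) - clipf M g x)%R <= d%:E)%E.
  by near: n; exact: gcvg.
have mfg : mfun (fun x => f x - clipf M g x) by exact: measurable_funB.
have msh : mfun (fun x => f (x + h n) - clipf M g (x + h n)).
  exact: (measurable_shift _ (h n) mfg).
have sh : (normW s (fun x => f (x + h n) - clipf M g (x + h n))%R <= (C * (4 * d))%:E)%E.
  apply: (le_trans (normW_shift s (fun x => f x - clipf M g x) (h n) s0 mfg)).
  rewrite (EFinM C); apply: lee_pmul => //.
  - by rewrite lee_fin mulr_ge0 ?powR_ge0 ?wt_ge0.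
  - exact: normW_ge0.
  - rewrite lee_fin ler_wpM2l ?powR_ge0// wt_homo//.
    by rewrite (le_trans hn)// ler_norm.
have gf : (normW s (fun x => - (f x - clipf M g x))%R <= (4 * d)%:E)%E by rewrite normWN.
have mgf : mfun (fun x => - (f x - clipf M g x)) by exact: measurableT_comp.
have mgn : mfun (fun x => clipf M g (x + h n) - clipf M g x).
  by apply: measurable_funB => //; exact: measurable_shift.
have S1 := le_normWD_fin s _ _ _ _ mgn mgf gn gf.
have S2 := le_normWD_fin s _ _ _ _ msh (measurable_funD mgn mgf) sh S1.
apply: le_trans (le_trans S2 _).
  by rewrite le_eqVlt; apply/orP; left; apply/eqP/eq_normW => x /=; ring.
rewrite lee_fin.
have -> : 2 * (C * (4 * d)) + 2 * (2 * d + 2 * (4 * d)) = d * (8 * C + 20) by ring.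
by rewrite /d divfK//; apply: lt0r_neq0; lra.
Unshelve. all: by end_near. Qed.

End translation_continuity.

(** * Measurability and Fubini for integrals with a parameter *)

Section parameter_integrals.
Context {R : realType}.
Notation mu := (@lebesgue_measure R).
Local Notation mfun f := (measurable_fun (setT : set R) (f : R -> R)).
Local Notation mfun2 f := (measurable_fun (setT : set (R * R)) (f : R * R -> R)).

(** Tonelli gives measurability for the positive and negative parts, and [Rintegral] is [fine] of
    the difference of their integrals, so no integrability is assumed. *)
Lemma measurable_Rintegral_param (f : R * R -> R) : mfun2 f ->
  mfun (fun x => \int[mu]_y f (x, y)).
Proof.
move=> mf; apply: measurableT_comp; first exact: fine_measurable.
have mE : measurable_fun setT (EFin \o f) by exact/measurable_EFinP.
rewrite (_ : (fun x => _) = (fun x => \int[mu]_y ((EFin \o f)^\+ (x, y)) -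
    \int[mu]_y ((EFin \o f)^\- (x, y))))%E; last first.
  apply/funext => x; rewrite integralE; congr (_ - _)%E; apply: eq_integral => y _.
    by rewrite !funeposE.
  by rewrite !funenegE.
apply: emeasurable_funB.
  by apply: measurable_fun_fubini_tonelli_F => //; exact: measurable_funepos.
by apply: measurable_fun_fubini_tonelli_F => //; exact: measurable_funeneg.
Qed.

(** The integrand is dominated by [|p x| |q y|]. In the applications [b] is a cosine or sine of a
    multiple of [x y]. *)
Lemma integrable_prod_bounded (p q : R -> R) (b : R * R -> R) :
  mu.-integrable setT (EFin \o p) -> mu.-integrable setT (EFin \o q) ->
  mfun2 b -> (forall z, `|b z| <= 1) ->
  (mu \x mu)%E.-integrable setT (EFin \o (fun z => p z.1 * q z.2 * b z)).
Proof.
move=> ip iq mb b1.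
have mp : mfun p by have /measurable_EFinP := measurable_int _ ip.
have mq : mfun q by have /measurable_EFinP := measurable_int _ iq.
have mpq : mfun2 (fun z => p z.1 * q z.2 * b z).
  apply: measurable_funM => //; apply: measurable_funM.
    exact: (measurableT_comp mp measurable_fst).
  exact: (measurableT_comp mq measurable_snd).
apply/integrable12ltyP; first exact/measurable_EFinP.
have pn := intR_integrable _ ip; have qn := intR_integrable _ iq.
set Q := intR (fun x => `|q x|).
have Q0 : (0 <= Q)%E by exact: intR_ge0.
apply: (@le_lt_trans _ _ (\int[mu]_x (`|p x|%:E * Q))%E); last first.
  rewrite -(fineK (_ : Q \is a fin_num)) ?ge0_fin_numE//.
  under eq_integral do rewrite -EFinM mulrC.
  rewrite -/(intR (fun x => fine Q * `|p x|)) intRZ//.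
  - by rewrite lte_mul_pinfty// lee_fin fine_ge0.
  - by rewrite fine_ge0.
  - exact: measurableT_comp.
apply: ge0_le_integral => //.
- by move=> x _; apply: integral_ge0 => y _; exact: abse_ge0.
- apply: (@measurable_fun_fubini_tonelli_F _ _ _ _ _ mu
     (fun z => `| (p z.1 * q z.2 * b z)%:E|%E)) => //.
  by apply: measurableT_comp => //; exact/measurable_EFinP.
- apply: emeasurable_funM => //.
  by apply/measurable_EFinP; exact: measurableT_comp.
- move=> x _; rewrite /Q -intRZ//; last by exact: measurableT_comp.
  apply: ge0_le_integral => //.
  + apply: measurableT_comp => //; apply/measurable_EFinP.
    by apply: (measurableT_comp mpq); exact: pair1_measurable.
  + by apply/measurable_EFinP; apply: measurable_funM => //; exact: measurableT_comp.
  + by move=> y _ /=; rewrite lee_fin !normrM -[leRHS]mulr1 ler_pM.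
Qed.

Lemma integrable_prod_section (q : R -> R) (b : R * R -> R) x :
  mu.-integrable setT (EFin \o q) ->
  mfun2 b -> (forall z, `|b z| <= 1) ->
  mu.-integrable setT (fun y => (q y * b (x, y))%:E).
Proof.
move=> iq mb b1; have mq : mfun q by have /measurable_EFinP := measurable_int _ iq.
apply: le_integrable iq => //=.
  apply/measurable_EFinP; apply: measurable_funM => //.
  by apply: (measurableT_comp mb); exact: pair1_measurable.
by move=> y _; rewrite lee_fin normrM -[leRHS]mulr1 ler_wpM2l.
Qed.

Lemma fubini_F_bounded (p q : R -> R) (b : R * R -> R) :
  mu.-integrable setT (EFin \o q) -> mfun2 b -> (forall z, `|b z| <= 1) ->
  fubini_F mu (EFin \o (fun z => p z.1 * q z.2 * b z)) =
    (fun x => (p x * \int[mu]_y (q y * b (x, y)))%:E).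
Proof.
move=> iq mb b1; apply/funext => x; rewrite /fubini_F /=.
have iqb := integrable_prod_section q b x iq mb b1.
under eq_integral do rewrite -mulrA EFinM.
rewrite integralZl// EFinM; congr (_ * _)%E.
by rewrite /Rintegral fineK// integrable_fin_num.
Qed.

Lemma integrable_bounded_param (p q : R -> R) (b : R * R -> R) :
  mu.-integrable setT (EFin \o p) -> mu.-integrable setT (EFin \o q) ->
  mfun2 b -> (forall z, `|b z| <= 1) ->
  mu.-integrable setT (fun x => (p x * \int[mu]_y (q y * b (x, y)))%:E).
Proof.
move=> ip iq mb b1; rewrite -fubini_F_bounded//.
by apply: integrable_fubini_F; exact: integrable_prod_bounded.
Qed.

Lemma Fubini_bounded (p q : R -> R) (b : R * R -> R) :
  mu.-integrable setT (EFin \o p) -> mu.-integrable setT (EFin \o q) ->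
  mfun2 b -> (forall z, `|b z| <= 1) ->
  \int[mu]_x (p x * \int[mu]_y (q y * b (x, y))) =
  \int[mu]_y (q y * \int[mu]_x (p x * b (x, y))).
Proof.
move=> ip iq mb b1.
have ipq := integrable_prod_bounded p q b ip iq mb b1.
have E1 := fubini_F_bounded p q b iq mb b1.
have mb' : mfun2 (fun z => b (z.2, z.1)).
  by apply: (measurableT_comp mb); exact: measurable_swap.
have E2 : fubini_G mu (EFin \o (fun z => p z.1 * q z.2 * b z)) =
    (fun y => (q y * \int[mu]_x (p x * b (x, y)))%:E).
  rewrite -(fubini_F_bounded q p (fun z => b (z.2, z.1)) ip mb' (fun z => b1 _)).
  by apply/funext => y; apply: eq_integral => x _ /=; rewrite (mulrC (p x)).
have F1 x := esym (congr1 (fun h => h x) E1).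
have F2 y := congr1 (fun h => h y) E2.
rewrite /Rintegral; congr fine.
transitivity (\int[mu]_x \int[mu]_y (EFin \o (fun z => p z.1 * q z.2 * b z)%R) (x, y))%E.
  by apply: eq_integral => x _; exact: F1.
by rewrite (Fubini ipq); apply: eq_integral => y _; exact: F2.
Qed.

End parameter_integrals.

(** * Cosine and sine transforms of a cut-off and their decay *)

Section fourier_coefficients.
Context {R : realType}.
Notation mu := (@lebesgue_measure R).
Local Notation mfun f := (measurable_fun (setT : set R) (f : R -> R)).

Definition bump (chi : R -> R) :=
  smooth chi /\ forall x, 2 < `|x| -> chi x = 0.

Lemma derivable1_continuous (f : R -> R) x : derivable f x 1 -> {for x, continuous f}.
Proof. by move=> /derivable1_diffP/differentiable_continuous. Qed.

Lemma smooth_continuous (chi : R -> R) n : smooth chi -> continuous (derive1n n chi).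
Proof. by move=> sc x; exact/derivable1_continuous/sc. Qed.

Lemma smooth_is_derive (chi : R -> R) (n : nat) (x : R) : smooth chi ->
  is_derive x 1 (derive1n n chi) (derive1n n.+1 chi x).
Proof.
move=> sc; apply: DeriveDef; first exact: sc.
by rewrite derive1nS derive1E.
Qed.

Lemma derive1n_supp (chi : R -> R) n x : bump chi -> 2 < `|x| -> derive1n n chi x = 0.
Proof.
move=> [sc c0]; elim: n x => [|n IH] x x2; first exact: c0.
rewrite derive1nS derive1E (@near_eq_derive _ _ _ _ (cst 0)) ?derive_cst//.
have H : `|y| @[y --> x] --> `|x| by exact: norm_continuous.
have : \forall y \near x, 2 < `|y| by exact: (cvgr_gt _ H).
by apply: filterS => y /IH.
Qed.

(** The ends [3] and [-3] lie strictly outside the support, so that boundary terms vanish there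
    without any discussion of the points [2] and [-2]. *)
Lemma integral_supp (g : R -> R) : (forall x, 2 < `|x| -> g x = 0) ->
  \int[mu]_x g x = \int[mu]_(x in `[-3, 3]) g x.
Proof.
move=> g0; rewrite [RHS]Rintegral_mkcond; apply: eq_Rintegral => x _.
rewrite patchE; case: ifPn => //; rewrite notin_setE/= in_itv/= => /negP x3.
apply: g0; rewrite ltNge; apply/negP; rewrite ler_norml => /andP[h1 h2].
by apply: (negP x3); apply/andP; split; lra.
Qed.

Lemma integrable_supp (g : R -> R) : continuous g -> (forall x, 2 < `|x| -> g x = 0) ->
  mu.-integrable setT (EFin \o g).
Proof.
move=> cg g0.
have i3 : mu.-integrable `[-3, 3] (EFin \o g).
  apply: continuous_compact_integrable; first exact: segment_compact.
  exact: continuous_subspaceT.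
move/integrable_mkcond : i3 => /(_ (measurable_itv _)).
congr (mu.-integrable setT _); apply/funext => x /=.
rewrite patchE; case: ifPn => //; rewrite notin_setE/= in_itv/= => /negP x3.
congr EFin; apply/esym/g0; rewrite ltNge; apply/negP; rewrite ler_norml => /andP[h1 h2].
by apply: (negP x3); apply/andP; split; lra.
Qed.

Lemma integrable_supp_mul (g b : R -> R) :
  continuous g -> (forall x, 2 < `|x| -> g x = 0) -> continuous b ->
  mu.-integrable setT (EFin \o (fun x => g x * b x)).
Proof.
move=> cg g0 cb; apply: integrable_supp => x.
  by apply: continuousM; [exact: cg|exact: cb].
by move=> /g0 ->; rewrite mul0r.
Qed.

(** Two integrations by parts in one step, valid for every solution of [b'' = - c^2 b]; cosine and
    sine are treated together. *)
Lemma integral_derive2_osc (chi b b1 : R -> R) (c : R) n : bump chi ->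
  (forall x : R, is_derive x 1 b (b1 x)) ->
  (forall x : R, is_derive x 1 b1 (- (c ^+ 2 * b x))) ->
  \int[mu]_x (derive1n n.+2 chi x * b x) =
  - (c ^+ 2 * \int[mu]_x (derive1n n chi x * b x)).
Proof.
move=> bc db db1; have [sc c0] := bc.
have cb : continuous b by move=> x; apply: derivable1_continuous; exact: (@ex_derive _ _ _ _ _ _ _ (db x)).
have i1 := integrable_supp_mul _ b (smooth_continuous _ n.+2 sc)
  (fun x => derive1n_supp _ n.+2 x bc) cb.
have i0 := integrable_supp_mul _ b (smooth_continuous _ n sc)
  (fun x => derive1n_supp _ n x bc) cb.
apply/eqP; rewrite -subr_eq0 opprK -RintegralZl//.
have i0c : mu.-integrable setT (EFin \o (fun x => c ^+ 2 * (derive1n n chi x * b x))).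
  rewrite (_ : _ \o _ = (fun x => (c ^+ 2)%:E * (EFin \o (fun x => derive1n n chi x * b x)%R) x)%E).
    exact: integrableZl.
  by apply/funext => x /=; rewrite EFinM.
rewrite -RintegralD// integral_supp; last first.
  by move=> x x2; rewrite !derive1n_supp// !mul0r mulr0 addr0.
(* In the derivative of [G] the two products of first derivatives cancel, which leaves exactly the
   sum to be integrated. *)
pose G x := derive1n n.+1 chi x * b x - derive1n n chi x * b1 x.
have dG (x : R) : is_derive x 1 G (derive1n n.+2 chi x * b x + c ^+ 2 * (derive1n n chi x * b x)).
  have d1 := smooth_is_derive chi n.+1 x sc.
  have d0 := smooth_is_derive chi n x sc.
  have H := is_deriveB (is_deriveM d1 (db x)) (is_deriveM d0 (db1 x)).
  by apply: (is_derive_eq H); rewrite /GRing.scale/=; ring.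
have G3 x : 2 < `|x| -> G x = 0 by move=> x2; rewrite /G !derive1n_supp// !mul0r subrr.
have n3 : 2 < `|3 : R| by rewrite ger0_norm; lra.
rewrite /Rintegral (@continuous_FTC2 _ _ G).
- by rewrite -EFinB !G3 ?normrN// subrr.
- lra.
- apply: continuous_subspaceT => x; apply: cvgD.
    by apply: cvgM; [exact: (smooth_continuous _ n.+2 sc)|exact: cb].
  apply: cvgM; first exact: cvg_cst.
  by apply: cvgM; [exact: (smooth_continuous _ n sc)|exact: cb].
- have cG : continuous G by move=> x; apply: derivable1_continuous; exact: (@ex_derive _ _ _ _ _ _ _ (dG x)).
  split; first by move=> x _; exact: (@ex_derive _ _ _ _ _ _ _ (dG x)).
    by apply: cvg_at_right_filter; exact: cG.
  by apply: cvg_at_left_filter; exact: cG.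
- by move=> x _; rewrite derive1E (@derive_val _ _ _ _ _ _ _ (dG x)).
Qed.

Lemma integral_derive_even_osc (chi b b1 : R -> R) (c : R) n : bump chi ->
  (forall x : R, is_derive x 1 b (b1 x)) ->
  (forall x : R, is_derive x 1 b1 (- (c ^+ 2 * b x))) ->
  \int[mu]_x (derive1n n.*2 chi x * b x) =
  (- c ^+ 2) ^+ n * \int[mu]_x (chi x * b x).
Proof.
move=> bc db db1; elim: n => [|n IH]; first by rewrite expr0 mul1r.
by rewrite doubleS (integral_derive2_osc _ _ b1 c)// IH (exprS (- c ^+ 2) n) !mulNr !mulrA.
Qed.

Lemma osc_bound (chi b b1 : R -> R) (c : R) n : bump chi ->
  (forall x : R, is_derive x 1 b (b1 x)) ->
  (forall x : R, is_derive x 1 b1 (- (c ^+ 2 * b x))) ->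
  (forall x, `|b x| <= 1) ->
  (c ^+ 2) ^+ n * `|\int[mu]_x (chi x * b x)| <=
  \int[mu]_x `|derive1n n.*2 chi x|.
Proof.
move=> bc db db1 b1x; have [sc c0] := bc.
have cb : continuous b by move=> x; apply: derivable1_continuous; exact: (@ex_derive _ _ _ _ _ _ _ (db x)).
have i1 := integrable_supp_mul _ b (smooth_continuous _ n.*2 sc)
  (fun x => derive1n_supp _ n.*2 x bc) cb.
have i0 := integrable_supp _ (smooth_continuous _ n.*2 sc)
  (fun x => derive1n_supp _ n.*2 x bc).
have -> : (c ^+ 2) ^+ n * `|\int[mu]_x (chi x * b x)| =
    `|\int[mu]_x (derive1n n.*2 chi x * b x)|.
  rewrite (integral_derive_even_osc _ _ b1 c)// normrM normrX normrN.
  by rewrite (ger0_norm (sqr_ge0 c)).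
apply: (le_trans (le_normr_Rintegral _ i1)) => //.
apply: le_Rintegral => //.
- exact: (integrable_norm i1).
- exact: (integrable_norm i0).
- by move=> x _; rewrite normrM ler_piMr.
Qed.

(** The kernel [k] of the overview is [ftrig cos chi + i ftrig sin chi], which is the Fourier
    transform of [chi] at [- eta]. *)
Definition ftrig (b chi : R -> R) (eta : R) : R :=
  \int[mu]_y (chi y * b (2 * pi * (y * eta))).

Definition trig (b : R -> R) := b = cos \/ b = sin.

Lemma trig_le1 b x : trig b -> `|b x| <= 1.
Proof.
case=> ->; first by rewrite ler_norml cos_geN1 cos_le1.
by rewrite ler_norml sin_geN1 sin_le1.
Qed.

Lemma trig_continuous b : trig b -> continuous b.
Proof. by case=> ->; [exact: continuous_cos|exact: continuous_sin]. Qed.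

Lemma trig_osc (b : R -> R) (c : R) : trig b -> exists2 b1 : R -> R,
  (forall x : R, is_derive x 1 (fun x => b (c * x)) (b1 x)) &
  (forall x : R, is_derive x 1 b1 (- (c ^+ 2 * b (c * x)))).
Proof.
have dc (x : R) : is_derive x 1 (fun x => c * x) c.
  have H := is_deriveZ c (is_derive_id x 1).
  by apply: (is_derive_eq H); rewrite /GRing.scale/= mulr1.
have ds (x : R) : is_derive x 1 (fun x => sin (c * x)) (c * cos (c * x)).
  have H := is_derive1_comp (is_derive_sin (c * x)) (dc x).
  by apply: (is_derive_eq H); rewrite mulrC.
have dco (x : R) : is_derive x 1 (fun x => cos (c * x)) (- (c * sin (c * x))).
  have H := is_derive1_comp (is_derive_cos (c * x)) (dc x).
  by apply: (is_derive_eq H); ring.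
case=> ->.
  exists (fun x => - (c * sin (c * x))) => // x.
  have H := is_deriveN (is_deriveZ c (ds x)).
  by apply: (is_derive_eq H); rewrite /GRing.scale/= mulrA.
exists (fun x => c * cos (c * x)) => // x.
have H := is_deriveZ c (dco x).
by apply: (is_derive_eq H); rewrite /GRing.scale/= mulrN mulrA.
Qed.

(** With [c = 2 pi eta], repeated integration by parts bounds [c^(2 n) |ftrig b chi eta|]. For
    [eta^2 <= 1] the bound with [n = 0] is enough; otherwise [1 + eta^2 <= 2 c^2], and [n = p]
    serves. *)
Lemma ftrig_decay (b chi : R -> R) p : trig b -> bump chi ->
  exists2 C, 0 <= C & forall eta, `|ftrig b chi eta| * (1 + eta ^+ 2) ^+ p <= C.
Proof.
move=> tb bc.
pose A n := \int[mu]_x `|derive1n n.*2 chi x|.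
have A0 n : 0 <= A n by apply: Rintegral_ge0.
exists (2 ^+ p * (A 0%N + A p)); first by rewrite mulr_ge0 ?addr_ge0// exprn_ge0.
move=> eta; set c := 2 * pi * eta.
have H n : (c ^+ 2) ^+ n * `|ftrig b chi eta| <= A n.
  have [b1 d0 d1] := trig_osc b c tb.
  have := osc_bound chi _ b1 c n bc d0 d1 (fun x => trig_le1 b _ tb).
  congr (_ * `|_| <= _); apply: eq_Rintegral => x _; congr (_ * b _).
  by rewrite /c; ring.
have [e1|e1] := leP (eta ^+ 2) 1.
  rewrite mulrC; apply: ler_pM => //; first by rewrite exprn_ge0// addr_ge0 ?sqr_ge0.
    by rewrite lerXn2r ?nnegrE ?addr_ge0 ?sqr_ge0//; lra.
  by have := H 0%N; rewrite expr0 mul1r => /le_trans; apply; rewrite lerDl.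
have ec : eta ^+ 2 <= c ^+ 2.
  rewrite /c exprMn ler_peMl ?sqr_ge0// exprn_ege1//.
  by have := pi_ge2 R; lra.
have le2 : 1 + eta ^+ 2 <= 2 * c ^+ 2.
  by apply: (le_trans (lerD (ltW e1) (lexx _))); rewrite mulr_natl -mulr2n ler_wMn2r.
have le1 : (1 + eta ^+ 2) ^+ p <= (2 * c ^+ 2) ^+ p.
  have e0 := ltW (onePsqr_gt0 eta).
  by apply: lerXn2r => //; rewrite nnegrE// (le_trans e0).
apply: (@le_trans _ _ (`|ftrig b chi eta| * (2 * c ^+ 2) ^+ p)); first by rewrite ler_wpM2l.
rewrite exprMn mulrCA ler_wpM2l ?exprn_ge0// mulrC.
by apply: (le_trans (H p)); rewrite lerDr.
Qed.

Lemma measurable_trig_prod b : trig b ->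
  measurable_fun (setT : set (R * R)) (fun z => b (2 * pi * (z.1 * z.2))).
Proof.
move=> tb; apply: measurableT_comp.
  by apply: continuous_measurable_fun; exact: trig_continuous.
by apply: measurable_funM => //; exact: measurable_funM.
Qed.

Lemma measurable_ftrig b chi : trig b -> continuous chi -> mfun (ftrig b chi).
Proof.
move=> tb cc.
apply: (@measurable_Rintegral_param _ (fun z => chi z.2 * b (2 * pi * (z.2 * z.1)))).
apply: measurable_funM.
  by apply: (measurableT_comp _ measurable_snd); exact: continuous_measurable_fun.
apply: measurableT_comp.
  by apply: continuous_measurable_fun; exact: trig_continuous.
by apply: measurable_funM => //; exact: measurable_funM.
Qed.

Lemma intR_oneDsqrV : intR (fun x : R => (1 + x ^+ 2)^-1) = pi%:E.
Proof.
rewrite /intR (@ge0_symfun_integralT R (fun x => (oneDsqr x)^-1)); last 3 first.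
- by move=> x; rewrite invr_ge0.
- exact: continuous_oneDsqrV.
- by move=> x; rewrite /= /oneDsqr sqrrN.
rewrite (_ : [set x | _] = `[0, +oo[%classic); last first.
  by apply/seteqP; split => x /=; rewrite in_itv/= andbT.
by rewrite integral0y_oneDsqr -EFinM; congr EFin; rewrite mulrC divfK.
Qed.

Lemma wt_le_exp (s : R) p x : s / 2 <= p%:R -> wt s x <= (1 + x ^+ 2) ^+ p.
Proof.
move=> sp; rewrite -powR_mulrn ?addr_ge0 ?sqr_ge0//; apply: ler_powR => //.
by rewrite lerDl sqr_ge0.
Qed.

Lemma intR_wt_ftrig (s : R) b chi : trig b -> bump chi ->
  (intR (fun x => wt s x * `|ftrig b chi x|)%R < +oo)%E.
Proof.
move=> tb bc; have [sc _] := bc.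
have [p sp] : exists p : nat, s / 2 <= p%:R.
  exists (Num.truncn (s / 2)).+1; exact/ltW/truncnS_gt.
(* Of the [p + 1] powers of [1 + x^2], [p] outweigh [wt s x] and the last leaves the integrable
   bound [(1 + x^2)^-1]. *)
have [C C0 HC] := ftrig_decay b chi p.+1 tb bc.
have mV : mfun (fun x => (1 + x ^+ 2)^-1).
  by apply: continuous_measurable_fun; exact: continuous_oneDsqrV.
apply: (@le_lt_trans _ _ (intR (fun x => C * (1 + x ^+ 2)^-1))); last first.
  rewrite intRZ//; last by move=> x; rewrite invr_ge0 ltW// onePsqr_gt0.
  by rewrite intR_oneDsqrV -EFinM ltry.
apply: le_intR.
- apply: measurable_funM; first exact: measurable_wt.
  apply: measurableT_comp => //; apply: measurable_ftrig => //.
  exact: (smooth_continuous _ 0%N).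
- exact: measurable_funM.
- by move=> x; rewrite mulr_ge0// wt_ge0.
move=> x; rewrite ler_pdivlMr ?onePsqr_gt0//; apply: le_trans (HC x).
rewrite (exprSr _ p) mulrA ler_wpM2r ?(ltW (onePsqr_gt0 _))//.
by rewrite mulrC ler_wpM2l// wt_le_exp.
Qed.

Lemma integrable_ftrig b chi : trig b -> bump chi ->
  mu.-integrable setT (EFin \o ftrig b chi).
Proof.
move=> tb bc; have [sc _] := bc.
have mk : mfun (ftrig b chi).
  by apply: measurable_ftrig => //; exact: (smooth_continuous _ 0%N).
apply/integrableP; split; first exact/measurable_EFinP.
apply: le_lt_trans (intR_wt_ftrig 0 b chi tb bc).
apply: le_intR => //.
- exact: measurableT_comp.
- by apply: measurable_funM; [exact: measurable_wt|exact: measurableT_comp].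
- by move=> x; rewrite ler_peMl// wt_ge1.
Qed.

End fourier_coefficients.

(** * The damped cosine integral, giving the Poisson kernel *)

Section fourier_inversion.
Context {R : realType}.
Notation mu := (@lebesgue_measure R).
Local Notation mfun f := (measurable_fun (setT : set R) (f : R -> R)).

Lemma is_derive_Ml (c x : R) : is_derive x 1 (fun x => c * x) c.
Proof.
have H := is_deriveZ c (is_derive_id x 1).
by apply: (is_derive_eq H); rewrite /GRing.scale/= mulr1.
Qed.

Lemma continuous_Ml (c : R) : continuous (fun x : R => c * x).
Proof. by move=> x; apply: cvgM; [exact: cvg_cst|exact: cvg_id]. Qed.

Lemma cvg_expRNM (e : R) : 0 < e -> expR (- (e * x)) @[x --> +oo] --> (0 : R).
Proof.
move=> e0; apply/cvgrPdist_le => d d0.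
near=> x; rewrite sub0r normrN ger0_norm ?expR_ge0// expRN.
rewrite -[leRHS]invrK lef_pV2 ?posrE ?expR_gt0 ?invr_gt0//.
apply: (@le_trans _ _ (e * x)); last first.
  by rewrite (le_trans _ (expR_ge1Dx _))// lerDr.
rewrite mulrC -ler_pdivrMr//; near: x; apply: nbhs_pinfty_ge; exact: num_real.
Unshelve. all: by end_near. Qed.

(* The 1 added to the cosine makes the integrand nonnegative, as required by
   [ge0_continuous_FTC2y]. *)
Lemma integral0y_exp_1cos (e c : R) : 0 < e ->
  (\int[mu]_(x in `[0%R, +oo[) (expR (- (e * x)) * (1 + cos (c * x)))%:E =
   (e^-1 + e / (e ^+ 2 + c ^+ 2))%:E)%E.
Proof.
move=> e0.
have D0 : 0 < e ^+ 2 + c ^+ 2 by rewrite ltr_pwDl ?exprn_gt0// sqr_ge0.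
pose E x := expR (- (e * x)).
pose K x := - e^-1 + (c * sin (c * x) - e * cos (c * x)) / (e ^+ 2 + c ^+ 2).
pose F x := E x * K x.
have dE (x : R) : is_derive x 1 E (- e * E x).
  have H1 : is_derive x 1 (fun x => - (e * x)) (- e) := is_deriveN (is_derive_Ml e x).
  have H := @is_derive1_comp _ expR (fun x => - (e * x)) x _ _ (is_derive_expR _) H1.
  by apply: (is_derive_eq H); rewrite mulrC.
have dK (x : R) : is_derive x 1 K ((c ^+ 2 * cos (c * x) + e * c * sin (c * x)) / (e ^+ 2 + c ^+ 2)).
  have Hs := is_derive1_comp (is_derive_sin (c * x)) (is_derive_Ml c x).
  have Hc := is_derive1_comp (is_derive_cos (c * x)) (is_derive_Ml c x).
  have H := is_deriveD (is_derive_cst (- e^-1 : R) x 1)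
    (is_deriveZ (e ^+ 2 + c ^+ 2)^-1 (is_deriveB (is_deriveZ c Hs) (is_deriveZ e Hc))).
  have -> : K = (cst (- e^-1 : R) + (e ^+ 2 + c ^+ 2)^-1 *:
     (c *: (sin \o (fun x => c * x)) - e *: (cos \o (fun x => c * x)))).
    by apply/funext => y; rewrite /K mulrC.
  by apply: (is_derive_eq H); rewrite /GRing.scale/=; ring.
have dF (x : R) : is_derive x 1 F (expR (- (e * x)) * (1 + cos (c * x))).
  have H := is_deriveM (dE x) (dK x).
  apply: (is_derive_eq H); rewrite /GRing.scale/= /K -/(E x).
  have ne : e != 0 by exact: lt0r_neq0.
  by field; rewrite ne lt0r_neq0.
have cF : continuous F.
  by move=> x; apply: derivable1_continuous; exact: (@ex_derive _ _ _ _ _ _ _ (dF x)).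
have Klim : F x @[x --> +oo] --> (0 : R).
  pose B := e^-1 + (`|c| + e) / (e ^+ 2 + c ^+ 2).
  have B0 : 0 <= B by have e0' := ltW e0; have D0' := ltW D0; rewrite addr_ge0 ?invr_ge0// divr_ge0// addr_ge0.
  have KB x : `|K x| <= B.
    apply: (le_trans (ler_normD _ _)); rewrite normrN.
    apply: lerD; first by rewrite ger0_norm// invr_ge0 ltW.
    rewrite normrM [X in _ * X <= _]ger0_norm ?invr_ge0 ?(ltW D0)//.
    rewrite ler_wpM2r ?invr_ge0 ?(ltW D0)//.
    apply: (le_trans (ler_normB _ _)); rewrite !normrM (ger0_norm (ltW e0)).
    apply: lerD.
      by rewrite ler_piMr//; apply: (@trig_le1 _ sin); right.
    by rewrite ler_piMr ?(ltW e0)//; apply: (@trig_le1 _ cos); left.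
  apply/cvgrPdist_le => d d0.
  have dB : 0 < d / (B + 1) by rewrite divr_gt0// ltr_wpDl.
  near=> x.
  rewrite sub0r normrN normrM (ger0_norm (expR_ge0 _)).
  apply: (@le_trans _ _ (E x * (B + 1))).
    by rewrite ler_wpM2l ?expR_ge0// (le_trans (KB x))// lerDl.
  rewrite -ler_pdivlMr; last by rewrite ltr_wpDl.
  near: x; have /cvgrPdist_le/(_ _ dB) := cvg_expRNM e e0.
  by apply: filterS => x; rewrite sub0r normrN ger0_norm ?expR_ge0.
rewrite (@ge0_continuous_FTC2y _ _ F _ 0).
- rewrite sub0e /F /E /K !mulr0 oppr0 expR0 sin0 cos0 -EFinN; congr EFin.
  by rewrite mulr0 mulr1 mul1r sub0r; ring.
- by move=> x _; apply: mulr_ge0; [exact: expR_ge0|have := cos_geN1 (c * x); lra].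
- apply: continuous_subspaceT => x; apply: cvgM.
    exact: (derivable1_continuous _ _ (@ex_derive _ _ _ _ _ _ _ (dE x))).
  apply: cvgD; first exact: cvg_cst.
  apply: (@continuous_comp _ _ _ (fun y => c * y) cos); first exact: continuous_Ml.
  exact: continuous_cos.
- exact: Klim.
- by move=> x _; exact: (@ex_derive _ _ _ _ _ _ _ (dF x)).
- by apply: cvg_at_right_filter; exact: cF.
- by move=> x _; rewrite derive1E (@derive_val _ _ _ _ _ _ _ (dF x)).
Unshelve. all: by end_near. Qed.

Lemma continuous_abel (e : R) : continuous (fun x : R => expR (- (e * `|x|))).
Proof.
move=> x; apply: (@continuous_comp _ _ _ (fun x : R => - (e * `|x|)) expR); last exact: continuous_expR.
apply: cvgN; apply: cvgM; first exact: cvg_cst.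
exact: norm_continuous.
Qed.

Lemma continuous_trigM (b : R -> R) (c : R) : trig b -> continuous (fun x => b (c * x)).
Proof.
move=> tb x; apply: (@continuous_comp _ _ _ (fun y => c * y) b); first exact: continuous_Ml.
exact: trig_continuous.
Qed.

Lemma intR_abel_1cos (e c : R) : 0 < e ->
  intR (fun x : R => expR (- (e * `|x|)) * (1 + cos (c * x))) =
  (2 * (e^-1 + e / (e ^+ 2 + c ^+ 2)))%:E.
Proof.
move=> e0; rewrite /intR (@ge0_symfun_integralT R (fun x : R => expR (- (e * `|x|)) * (1 + cos (c * x)))).
- rewrite EFinM -integral0y_exp_1cos//; congr (_ * _)%E.
  rewrite (_ : [set x | _] = `[0, +oo[%classic); last first.
    by apply/seteqP; split => x /=; rewrite in_itv/= andbT.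
  apply: eq_integral => x; rewrite inE/= in_itv/= andbT => x0.
  by rewrite ger0_norm.
- by move=> x; apply: mulr_ge0; [exact: expR_ge0|have := cos_geN1 (c * x); lra].
- move=> x; apply: cvgM; first exact: continuous_abel.
  apply: cvgD; first exact: cvg_cst.
  by apply: continuous_trigM; left.
- by move=> x /=; rewrite normrN mulrN cosN.
Qed.

(** Finiteness is read off the closed formula at [c = 0], where the integrand is twice the
    exponential. *)
Lemma integrable_abel (e : R) : 0 < e ->
  mu.-integrable setT (EFin \o (fun x : R => expR (- (e * `|x|)))).
Proof.
move=> e0; apply: integrable_intR.
- by apply: continuous_measurable_fun; exact: continuous_abel.
- by move=> x; exact: expR_ge0.
have := intR_abel_1cos e 0 e0; under eq_fun do rewrite mul0r cos0.
have -> : (fun x : R => expR (- (e * `|x|)) * (1 + 1)) = (fun x : R => 2 * expR (- (e * `|x|))).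
  by apply/funext => x; ring.
rewrite intRZ//; last first.
  by apply: continuous_measurable_fun; exact: continuous_abel.
(* An infinite integral would remain infinite after multiplication by 2, against the finite value of
   the formula. *)
case: (intR _) => [r _|/=|//]; first by rewrite ltry.
by rewrite mulry gtr0_sg// mul1e.
Qed.

Lemma integrable_abel_trig (e c : R) b : 0 < e -> trig b ->
  mu.-integrable setT (EFin \o (fun x : R => expR (- (e * `|x|)) * b (c * x))).
Proof.
move=> e0 tb; apply: le_integrable (integrable_abel e e0) => //.
  apply/measurable_EFinP; apply: continuous_measurable_fun => x.
  by apply: cvgM; [exact: continuous_abel|exact: continuous_trigM].
by move=> x _ /=; rewrite lee_fin normrM ler_piMr// trig_le1.
Qed.

(** The case [c = 0] of the formula for [1 + cos] evaluates the integral of the exponential alone,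
    which is then subtracted from the general case. *)
Lemma integral_abel_cos (e c : R) : 0 < e ->
  \int[mu]_x (expR (- (e * `|x|)) * cos (c * x)) = 2 * e / (e ^+ 2 + c ^+ 2).
Proof.
move=> e0.
have ia := integrable_abel e e0.
have ic := integrable_abel_trig e c cos e0 (or_introl erefl).
have H a : \int[mu]_x (expR (- (e * `|x|)) * (1 + cos (a * x))) =
    2 * (e^-1 + e / (e ^+ 2 + a ^+ 2)).
  by have := congr1 fine (intR_abel_1cos e a e0).
have S a : \int[mu]_x (expR (- (e * `|x|)) * (1 + cos (a * x))) =
    \int[mu]_x (expR (- (e * `|x|))) + \int[mu]_x (expR (- (e * `|x|)) * cos (a * x)).
  rewrite -RintegralD//; last exact: (integrable_abel_trig e a cos e0 (or_introl erefl)).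
  by apply: eq_Rintegral => x _; rewrite mulrDr mulr1.
have S0 : \int[mu]_x (expR (- (e * `|x|))) = 2 / e.
  have := S 0; rewrite H.
  have -> : \int[mu]_x (expR (- (e * `|x|)) * cos (0 * x)) = \int[mu]_x (expR (- (e * `|x|))).
    by apply: eq_Rintegral => x _; rewrite mul0r cos0 mulr1.
  rewrite expr0n/= addr0 => h.
  have e20 : e / e ^+ 2 = e^-1 by field; exact: lt0r_neq0.
  by rewrite e20 in h; lra.
have := S c; rewrite H S0 => h.
by apply: (addrI (2 / e)); rewrite -h mulrDr !mulrA.
Qed.

End fourier_inversion.

(** * Fourier inversion for cut-offs *)

Section fourier_inversion_formula.
Context {R : realType}.
Notation mu := (@lebesgue_measure R).
Local Notation mfun f := (measurable_fun (setT : set R) (f : R -> R)).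

Lemma dominated_Rintegral (f_ : nat -> R -> R) (f g : R -> R) :
  (forall n, mfun (f_ n)) -> mfun f -> mu.-integrable setT (EFin \o g) ->
  (forall n x, `|f_ n x| <= g x) ->
  (forall x, f_ n x @[n --> \oo] --> f x) ->
  \int[mu]_x f_ n x @[n --> \oo] --> \int[mu]_x f x.
Proof.
move=> mf_ mf ig fg fcvg.
have [] := @dominated_convergence _ _ R mu setT measurableT
  (fun n x => (f_ n x)%:E) (EFin \o f) (EFin \o g).
- by move=> n; apply/measurable_EFinP; exact: mf_.
- exact/measurable_EFinP.
- by apply: aeW => x _ /=; apply: cvg_EFin; [exact: nearW|exact: fcvg].
- exact: ig.
- by apply: aeW => x n _ /=; rewrite lee_fin.
- move=> fi _ H.
  have E : (\int[mu]_x (EFin \o f) x = (\int[mu]_x f x)%:E)%E.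
    by rewrite /Rintegral fineK//; exact: integrable_fin_num.
  by move: H; rewrite E => /fine_cvg.
Qed.

Lemma ge0_integral_oppr (f : R -> \bar R) :
  measurable_fun setT f -> (forall x, 0 <= f x)%E ->
  (\int[mu]_x f (- x)%R = \int[mu]_x f x)%E.
Proof.
move=> mf f0.
transitivity (\int[pushforward mu (-%R : R -> measurableTypeR R)]_x f x)%E.
  by rewrite ge0_integral_pushforward//.
by apply: eq_measure_integral => //= A mA _; exact: lebesgue_measureN.
Qed.

(** The reflection [x -> - x] exchanges the positive and negative parts of [f], whose integrals are
    thus equal. *)
Lemma Rintegral_odd (f : R -> R) : mfun f -> (forall x, f (- x) = - f x) ->
  \int[mu]_x f x = 0.
Proof.
move=> mf fo; rewrite /Rintegral integralE.
have mE : measurable_fun setT (EFin \o f) by exact/measurable_EFinP.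
have -> : (\int[mu]_x (fun x : R => (f x)%:E)^\- x = \int[mu]_x (fun x : R => (f x)%:E)^\+ x)%E.
  rewrite -(ge0_integral_oppr _ (measurable_funepos mE))//.
  by apply: eq_integral => x _; rewrite funeposE funenegE/= fo.
set I := (\int[mu]_x _)%E.
have : (0 <= I)%E by apply: integral_ge0.
(* If both integrals are [+oo], their difference is infinite and [fine] sends it to the default
   value [0], so integrability is not an issue. *)
by case: I => [r _|_|//]; rewrite /= ?subrr.
Qed.

(** Damping makes the double integral absolutely convergent, so Fubini applies. The addition formula
    merges the two products into [cos (2 pi (x - y) t)], whose damped integral is known. *)
Lemma abel_poisson (e x : R) (chi : R -> R) : 0 < e -> bump chi ->
  \int[mu]_t (expR (- (e * `|t|)) * (ftrig cos chi t * cos (2 * pi * x * t) +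
     ftrig sin chi t * sin (2 * pi * x * t))) =
  \int[mu]_y (chi y * (2 * e / (e ^+ 2 + (2 * pi * (x - y)) ^+ 2))).
Proof.
move=> e0 bc; have [sc c0] := bc; set c := 2 * pi * x.
have ichi : mu.-integrable setT (EFin \o chi).
  by apply: integrable_supp => //; exact: (smooth_continuous _ 0%N).
pose p b t := expR (- (e * `|t|)) * b (c * t).
have H b : trig b -> \int[mu]_t (p b t * ftrig b chi t) =
    \int[mu]_y (chi y * \int[mu]_t (p b t * b (2 * pi * (y * t)))) /\
  mu.-integrable setT (fun t => (p b t * ftrig b chi t)%:E) /\
  mu.-integrable setT (fun y => (chi y * \int[mu]_t (p b t * b (2 * pi * (y * t))))%:E).
  move=> tb; have ip := integrable_abel_trig e c b e0 tb.
  have mb1 : measurable_fun (setT : set (R * R)) (fun z => b (2 * pi * (z.2 * z.1))).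
    apply: measurableT_comp.
      by apply: continuous_measurable_fun; exact: trig_continuous.
    by apply: measurable_funM => //; exact: measurable_funM.
  split; [|split].
  - exact: (Fubini_bounded (p b) chi (fun z => b (2 * pi * (z.2 * z.1))) ip ichi mb1
      (fun z => trig_le1 _ _ tb)).
  - exact: (integrable_bounded_param (p b) chi (fun z => b (2 * pi * (z.2 * z.1))) ip ichi mb1
      (fun z => trig_le1 _ _ tb)).
  - exact: (integrable_bounded_param chi (p b) (fun z => b (2 * pi * (z.1 * z.2))) ichi ip
      (measurable_trig_prod b tb) (fun z => trig_le1 _ _ tb)).
have [Ec [ic ic']] := H cos (or_introl erefl).
have [Es [is_ is']] := H sin (or_intror erefl).
transitivity (\int[mu]_t (p cos t * ftrig cos chi t) + \int[mu]_t (p sin t * ftrig sin chi t)).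
  by rewrite -RintegralD//; apply: eq_Rintegral => t _; rewrite /p; ring.
rewrite Ec Es -RintegralD//; apply: eq_Rintegral => y _.
rewrite -mulrDr; congr (_ * _).
have I b : trig b -> mu.-integrable setT (EFin \o (fun t => p b t * b (2 * pi * (y * t)))).
  move=> tb; have ip := integrable_abel_trig e c b e0 tb.
  exact: (integrable_prod_section (p b) (fun z => b (2 * pi * (z.1 * z.2))) y ip
    (measurable_trig_prod b tb) (fun z => trig_le1 _ _ tb)).
rewrite -RintegralD//; last 2 first.
- by apply: I; left.
- by apply: I; right.
rewrite -integral_abel_cos//; apply: eq_Rintegral => t _.
rewrite /p -!mulrA -mulrDr; congr (_ * _).
by rewrite -cosB; congr cos; rewrite /c; ring.
Qed.

(** The substitution [y = x + e / (2 pi) z] turns the Poisson kernel of width [e] into the fixed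
    Cauchy density, leaving [e] only in the argument of [chi]; dominated convergence as [e -> 0]
    then applies. *)
Lemma poisson_substitution (e x : R) (chi : R -> R) : 0 < e ->
  continuous chi -> (forall x, 0 <= chi x) ->
  \int[mu]_y (chi y * (2 * e / (e ^+ 2 + (2 * pi * (x - y)) ^+ 2))) =
  \int[mu]_z (chi (x + e / (2 * pi) * z) * (pi^-1 / (1 + z ^+ 2))).
Proof.
move=> e0 cc c0.
have pi0 := pi_gt0 R.
pose d := e / (2 * pi).
have d0 : 0 < d by rewrite divr_gt0// mulr_gt0.
pose F z := x + d * z.
pose G y := chi y * (2 * e / (e ^+ 2 + (2 * pi * (x - y)) ^+ 2)).
have D0 y : 0 < e ^+ 2 + (2 * pi * (x - y)) ^+ 2.
  by rewrite ltr_pwDl ?exprn_gt0// sqr_ge0.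
have dF (z : R) : is_derive z 1 F d.
  have H := is_deriveD (is_derive_cst (x : R) z 1) (is_derive_Ml d z).
  by apply: (is_derive_eq H); rewrite add0r.
have F'E : F^`()%classic = cst d.
  by apply/funext => z; rewrite derive1E (@derive_val _ _ _ _ _ _ _ (dF z)).
have n1 : pi != 0 :> R by exact: lt0r_neq0.
have n2 : e != 0 by exact: lt0r_neq0.
have key z : G (F z) * d = chi (F z) * (pi^-1 / (1 + z ^+ 2)).
  rewrite /G -mulrA; congr (_ * _).
  have -> : 2 * pi * (x - F z) = - (e * z).
    have -> : x - F z = - (d * z) by rewrite /F; ring.
    have n3 : 2 * pi != 0 :> R by rewrite mulf_neq0.
    by rewrite mulrN /d mulrA (mulrC (2 * pi)) divfK.
  rewrite sqrrN exprMn (_ : e ^+ 2 + _ = e ^+ 2 * (1 + z ^+ 2)); last by ring.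
  have alg (q D E : R) : q != 0 -> D != 0 -> E != 0 ->
      2 * E / (E ^+ 2 * D) * (E / (2 * q)) = q^-1 / D.
    by move=> q0 D0' E0; field; rewrite q0 D0' E0.
  by rewrite alg// lt0r_neq0// onePsqr_gt0.
rewrite /Rintegral; congr fine.
rewrite (@increasing_ge0_integration_by_substitutionT _ F G).
- by apply: eq_integral => z _; rewrite F'E; exact: (congr1 EFin (key z)).
- by move=> y z yz; rewrite ltrD2l ltr_pM2l.
- by rewrite F'E; exact: cst_continuous.
- by rewrite F'E; exact: is_cvg_cst.
- by rewrite F'E; exact: is_cvg_cst.
- by move=> z; exact: (@ex_derive _ _ _ _ _ _ _ (dF z)).
- apply/cvgrNyPle => A; near=> z.
  have -> : (F z <= A) = (z <= (A - x) / d) by rewrite ler_pdivlMr// [z * d]mulrC lerBrDl.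
  by near: z; apply: nbhs_ninfty_le; exact: num_real.
- apply/cvgryPge => A; near=> z.
  have -> : (A <= F z) = ((A - x) / d <= z) by rewrite ler_pdivrMr// [z * d]mulrC lerBlDl.
  by near: z; apply: nbhs_pinfty_ge; exact: num_real.
- move=> y; apply: cvgM; first exact: cc.
  apply: cvgM; first exact: cvg_cst.
  apply: cvgV; first by rewrite lt0r_neq0.
  apply: cvgD; first exact: cvg_cst.
  have H : 2 * pi * (x - z) @[z --> y] --> 2 * pi * (x - y).
    apply: cvgM; first exact: cvg_cst.
    by apply: cvgB; [exact: cvg_cst|exact: cvg_id].
  exact: (cvgM H H).
- move=> y; rewrite mulr_ge0// divr_ge0 ?(ltW (D0 y))// mulr_ge0// ltW//.
Unshelve. all: by end_near. Qed.

Lemma integrable_cauchy : mu.-integrable setT (EFin \o (fun z : R => pi^-1 / (1 + z ^+ 2))).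
Proof.
have mV : mfun (fun x => (1 + x ^+ 2)^-1).
  by apply: continuous_measurable_fun; exact: continuous_oneDsqrV.
apply: integrable_intR.
- exact: measurable_funM.
- by move=> x; rewrite divr_ge0 ?invr_ge0 ?pi_ge0// ltW// onePsqr_gt0.
- rewrite intRZ ?invr_ge0 ?pi_ge0//; last by move=> x; rewrite invr_ge0 ltW// onePsqr_gt0.
  by rewrite intR_oneDsqrV -EFinM ltry.
Qed.

Lemma Rintegral_cauchy : \int[mu]_z (pi^-1 / (1 + z ^+ 2) : R) = 1.
Proof.
have mV : mfun (fun x => (1 + x ^+ 2)^-1).
  by apply: continuous_measurable_fun; exact: continuous_oneDsqrV.
rewrite /Rintegral -/(intR (fun z => pi^-1 / (1 + z ^+ 2))).
rewrite intRZ ?invr_ge0 ?pi_ge0//; last by move=> x; rewrite invr_ge0 ltW// onePsqr_gt0.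
by rewrite intR_oneDsqrV -EFinM/= mulVf// lt0r_neq0// pi_gt0.
Qed.

(** Two limits of one sequence, as the damping [e n = 1 / (n + 1)] disappears. On the frequency side
    the majorant is the sum of the moduli of the two transforms, integrable by their decay; on the
    Poisson side it is the Cauchy density, because [chi <= 1]. *)
Lemma fourier_inversion (x : R) (chi : R -> R) : bump chi -> (forall x, 0 <= chi x <= 1) ->
  \int[mu]_t (ftrig cos chi t * cos (2 * pi * x * t) +
     ftrig sin chi t * sin (2 * pi * x * t)) = chi x.
Proof.
move=> bc c01; have [sc c0] := bc.
have cc : continuous chi := smooth_continuous _ 0%N sc.
have chi0 y : 0 <= chi y by case/andP: (c01 y).
pose h t := ftrig cos chi t * cos (2 * pi * x * t) + ftrig sin chi t * sin (2 * pi * x * t).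
have mtrig b : trig b -> mfun (fun t => b (2 * pi * x * t)).
  by move=> tb; apply: continuous_measurable_fun; exact: continuous_trigM.
have mh : mfun h.
  by apply: measurable_funD; apply: measurable_funM;
    [apply: measurable_ftrig => //|apply: mtrig|apply: measurable_ftrig => //|apply: mtrig];
    (try by left); right.
have ig : mu.-integrable setT (EFin \o (fun t => `|ftrig cos chi t| + `|ftrig sin chi t|)).
  rewrite (_ : _ \o _ = (EFin \o (fun t => `|ftrig cos chi t|)%R) \+
     (EFin \o (fun t => `|ftrig sin chi t|)%R))%E; last by apply/funext.
  apply: integrableD => //; first by apply: (integrable_norm (integrable_ftrig cos chi (or_introl erefl) bc)).
  by apply: (integrable_norm (integrable_ftrig sin chi (or_intror erefl) bc)).
have hg t : `|h t| <= `|ftrig cos chi t| + `|ftrig sin chi t|.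
  apply: (le_trans (ler_normD _ _)); rewrite !normrM.
  by apply: lerD; rewrite ler_piMr//; [apply: (@trig_le1 _ cos); left|apply: (@trig_le1 _ sin); right].
pose e n : R := n.+1%:R^-1.
have e0 n : 0 < e n by rewrite invr_gt0.
have L1 : \int[mu]_t (expR (- (e n * `|t|)) * h t) @[n --> \oo] --> \int[mu]_t h t.
  apply: (dominated_Rintegral _ _ _ _ mh ig).
  - move=> n; apply: measurable_funM => //.
    by apply: continuous_measurable_fun; exact: continuous_abel.
  - move=> n t; rewrite normrM (ger0_norm (expR_ge0 _)); apply: le_trans (hg t).
    by rewrite ler_piMl// expR_le1 oppr_le0 mulr_ge0// ltW.
  - move=> t; rewrite -[X in _ --> X]mul1r; apply: cvgM; last exact: cvg_cst.
    rewrite -expR0; apply: continuous_cvg; first exact: continuous_expR.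
    rewrite -oppr0; apply: cvgN; rewrite -[X in _ --> X](mul0r `|t|).
    by apply: cvgM; [exact: cvg_harmonic|exact: cvg_cst].
have L2 : \int[mu]_t (expR (- (e n * `|t|)) * h t) @[n --> \oo] --> chi x.
  under eq_fun do rewrite abel_poisson// poisson_substitution//.
  have -> : chi x = \int[mu]_z (chi x * (pi^-1 / (1 + z ^+ 2))).
    by rewrite RintegralZl ?Rintegral_cauchy ?mulr1//; exact: integrable_cauchy.
  have mP : mfun (fun z => pi^-1 / (1 + z ^+ 2)).
    by have /measurable_EFinP := measurable_int _ integrable_cauchy.
  apply: (dominated_Rintegral _ _ _ _ _ integrable_cauchy).
  - move=> n; apply: measurable_funM => //; apply: continuous_measurable_fun => z.
    apply: continuous_comp; last exact: cc.
    apply: cvgD; first exact: cvg_cst.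
    by apply: cvgM; [exact: cvg_cst|exact: cvg_id].
  - by apply: measurable_funM.
  - move=> n z; rewrite normrM.
    rewrite [X in _ * X <= _]ger0_norm ?divr_ge0 ?invr_ge0 ?pi_ge0 ?(ltW (onePsqr_gt0 _))//.
    rewrite ler_piMl ?divr_ge0 ?invr_ge0 ?pi_ge0 ?(ltW (onePsqr_gt0 _))//.
    by rewrite ger0_norm//; case/andP: (c01 (x + e n / (2 * pi) * z)).
  - move=> z; apply: cvgM; last exact: cvg_cst.
    apply: continuous_cvg; first exact: cc.
    rewrite -[X in _ --> X]addr0; apply: cvgD; first exact: cvg_cst.
    rewrite -[X in _ --> X](mul0r ((2 * pi)^-1 * z)).
    under eq_fun do rewrite -mulrA.
    by apply: cvgM; [exact: cvg_harmonic|exact: cvg_cst].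
exact: (cvg_unique _ L1 L2).
Qed.

Lemma ftrig_cosN (chi : R -> R) t : ftrig cos chi (- t) = ftrig cos chi t.
Proof. by apply: eq_Rintegral => y _; rewrite !mulrN cosN. Qed.

Lemma ftrig_sinN (chi : R -> R) t : bump chi -> ftrig sin chi (- t) = - ftrig sin chi t.
Proof.
move=> bc; have [sc c0] := bc.
have i : mu.-integrable setT (EFin \o (fun y => chi y * sin (2 * pi * (y * t)))).
  apply: integrable_supp_mul => //; first exact: (smooth_continuous _ 0%N).
  under eq_fun do rewrite (mulrC _ t) mulrA.
  by apply: continuous_trigM; right.
rewrite /ftrig -[RHS]mulN1r -RintegralZl//; apply: eq_Rintegral => y _.
by rewrite !mulrN sinN mulrN mulN1r.
Qed.

(** The imaginary part of the inversion formula: the cosine transform is even in [t] and the sine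
    transform odd, so the integrand is odd. *)
Lemma fourier_inversion_im (x : R) (chi : R -> R) : bump chi ->
  \int[mu]_t (ftrig cos chi t * sin (2 * pi * x * t) -
     ftrig sin chi t * cos (2 * pi * x * t)) = 0.
Proof.
move=> bc; have [sc c0] := bc.
have cc : continuous chi := smooth_continuous _ 0%N sc.
have mtrig b : trig b -> mfun (fun t => b (2 * pi * x * t)).
  by move=> tb; apply: continuous_measurable_fun; exact: continuous_trigM.
apply: Rintegral_odd.
  apply: measurable_funB; apply: measurable_funM;
    [apply: measurable_ftrig => //|apply: mtrig|apply: measurable_ftrig => //|apply: mtrig];
    by [left|right].
by move=> t; rewrite ftrig_cosN ftrig_sinN// !mulrN cosN sinN; ring.
Qed.

End fourier_inversion_formula.

(** * Averages of translates in the weighted norm *)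

Section convolution.
Context {R : realType}.
Notation mu := (@lebesgue_measure R).
Local Notation mfun f := (measurable_fun (setT : set R) (f : R -> R)).
Local Notation mfun2 f := (measurable_fun (setT : set (R * R)) (f : R * R -> R)).

(** The scale [t] is [1 / r] in the application. The plus sign in [x + t * y], in place of the usual
    minus, matches the character [exp(-2 pi i x eta)] in the superposition of [chi]. *)
Definition conv (k f : R -> R) (t x : R) : R := \int[mu]_y (k y * f (x + t * y)).

Lemma measurable_affine2 (f : R -> R) t : mfun f -> mfun2 (fun z => f (z.1 + t * z.2)).
Proof.
move=> mf; apply: (measurableT_comp mf); apply: measurable_funD => //.
exact: measurable_funM.
Qed.

Lemma measurable_conv (k f : R -> R) t : mfun k -> mfun f -> mfun (conv k f t).
Proof.
move=> mk mf.
apply: (@measurable_Rintegral_param _ (fun z => k z.2 * f (z.1 + t * z.2))).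
by apply: measurable_funM; [exact: (measurableT_comp mk measurable_snd)|exact: measurable_affine2].
Qed.

(* Cauchy-Schwarz for the measure |k| dy; with [A + 1] in place of [A] the
   bound is not of the form 0 * +oo when the right-hand integral diverges. *)
Lemma sqr_integral_le (k g : R -> R) (A := \int[mu]_y `|k y|) :
  mu.-integrable setT (EFin \o k) -> mfun g ->
  (intR (fun y => `|k y| * g y ^+ 2)%R < +oo)%E ->
  mu.-integrable setT (EFin \o (fun y => k y * g y)) /\
  (((\int[mu]_y (k y * g y)) ^+ 2)%:E <= (A + 1)%:E * intR (fun y => `|k y| * g y ^+ 2)%R)%E.
Proof.
move=> ik mg Boo.
have mk : mfun k by have /measurable_EFinP := measurable_int _ ik.
have ink := integrable_norm ik.
have mnk : mfun (fun y => `|k y|) by exact: measurableT_comp.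
have mB : mfun (fun y => `|k y| * g y ^+ 2).
  by apply: measurable_funM => //; exact: measurable_funX.
have B0 y : 0 <= `|k y| * g y ^+ 2 by rewrite mulr_ge0 ?sqr_ge0.
have iB := integrable_intR _ mB B0 Boo.
have ikB : mu.-integrable setT (EFin \o (fun y => `|k y| + `|k y| * g y ^+ 2)).
  by rewrite (_ : _ \o _ = ((EFin \o (fun y => `|k y|)%R) \+ (EFin \o (fun y => `|k y| * g y ^+ 2)%R))%E);
    [exact: integrableD|exact/funext].
have ikg : mu.-integrable setT (EFin \o (fun y => k y * g y)).
  apply: le_integrable ikB => //=.
    by apply/measurable_EFinP; exact: measurable_funM.
  move=> y _; rewrite lee_fin normrM [leRHS]ger0_norm; last by rewrite addr_ge0.
  rewrite -[X in _ <= X + _]mulr1 -mulrDr ler_wpM2l//.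
  have := sqr_ge0 (`|g y| - 1); have := sqr_ge0 (g y).
  rewrite -(real_normK (num_real (g y))); nra.
split => //.
set S := \int[mu]_y (k y * g y).
pose T := \int[mu]_y (`|k y| * `|g y|).
have ikgn : mu.-integrable setT (EFin \o (fun y => `|k y| * `|g y|)).
  rewrite (_ : (fun y => `|k y| * `|g y|) = (fun y => `|k y * g y|)); first exact: integrable_norm.
  by apply/funext => y; rewrite normrM.
have ST : `|S| <= T.
  apply: (le_trans (le_normr_Rintegral _ ikg)) => //; rewrite /T le_eqVlt; apply/orP; left.
  by apply/eqP/eq_Rintegral => y _; rewrite normrM.
have A0 : 0 <= A by apply: Rintegral_ge0.
have T0 : 0 <= T by apply: Rintegral_ge0 => y _; rewrite mulr_ge0.
pose B := \int[mu]_y (`|k y| * g y ^+ 2).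
have -> : intR (fun y => `|k y| * g y ^+ 2) = B%:E.
  by rewrite /B /Rintegral fineK// integrable_fin_num.
(* Nearly the minimiser [T / A] of the integral of [|k| (|g| - l)^2], with a denominator that is
   never zero. Nonnegativity gives [l^2 (A + 2) <= B], hence [T^2 = l^2 (A + 1)^2 <= (A + 1) B]. *)
pose l := T / (A + 1).
have H : 0 <= B - 2 * l * T + l ^+ 2 * A.
  have i1 : mu.-integrable setT (EFin \o (fun y => (2 * l) * (`|k y| * `|g y|))).
    rewrite (_ : _ \o _ = (fun y => (2 * l)%:E * (EFin \o (fun y => `|k y| * `|g y|)%R) y)%E).
      exact: integrableZl.
    by apply/funext => y /=; rewrite EFinM.
  have i2 : mu.-integrable setT (EFin \o (fun y => l ^+ 2 * `|k y|)).
    rewrite (_ : _ \o _ = (fun y => (l ^+ 2)%:E * (EFin \o (fun y => `|k y|)%R) y)%E).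
      exact: integrableZl.
    by apply/funext => y /=; rewrite EFinM.
  have i3 : mu.-integrable setT (EFin \o (fun y => `|k y| * g y ^+ 2 - (2 * l) * (`|k y| * `|g y|))).
    by rewrite (_ : _ \o _ = ((EFin \o (fun y => `|k y| * g y ^+ 2)%R) \-
      (EFin \o (fun y => (2 * l) * (`|k y| * `|g y|))%R))%E); [exact: integrableB|exact/funext].
  rewrite -RintegralZl// -RintegralB// -RintegralZl// -RintegralD//.
  apply: Rintegral_ge0 => y _.
  rewrite (_ : _ + _ = `|k y| * (`|g y| - l) ^+ 2); first by rewrite mulr_ge0 ?sqr_ge0.
  by rewrite -(real_normK (num_real (g y))); ring.
rewrite -EFinM lee_fin -real_normK ?num_real//.
apply: (@le_trans _ _ (T ^+ 2)); first by rewrite lerXn2r ?nnegrE.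
have A1 : 0 < A + 1 by rewrite ltr_wpDl.
have E : T = l * (A + 1) by rewrite divfK// lt0r_neq0.
have l0 : 0 <= l by rewrite divr_ge0// ltW.
move: H; rewrite E; move: l l0 {E} => l l0 H.
have : (A + 1) * (l ^+ 2 * (A + 2)) <= (A + 1) * B.
  by rewrite ler_wpM2l ?(ltW A1)//; move: H; rewrite -subr_ge0 => H; nra.
apply: le_trans; rewrite exprMn expr2 [(A + 1) ^+ 2]expr2.
by have := sqr_ge0 l; nra.
Qed.

(** The mass of [k] times [f x] is the integral of [k y * f x], so Cauchy-Schwarz applies to the
    difference [f (x + t y) - f x]. *)
Lemma conv_sub_le (k f : R -> R) t x : mu.-integrable setT (EFin \o k) -> mfun f ->
  (((conv k f t x - (\int[mu]_y k y) * f x) ^+ 2)%:E <=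
   (\int[mu]_y `|k y| + 1)%:E * intR (fun y => `|k y| * (f (x + t * y) - f x) ^+ 2)%R)%E.
Proof.
move=> ik mf.
have mg : mfun (fun y => f (x + t * y) - f x).
  apply: measurable_funB => //; apply: (measurableT_comp mf).
  by apply: measurable_funD => //; exact: measurable_funM.
have A0 : 0 <= \int[mu]_y `|k y| by apply: Rintegral_ge0.
set B := intR _.
have [Boo|] := ltP B +oo%E; last first.
  rewrite leye_eq => /eqP ->; rewrite mulry gtr0_sg ?mul1e ?leey//.
  by rewrite ltr_wpDl.
have [ikg] := sqr_integral_le k _ ik mg Boo; congr (_ <= _)%E; congr EFin; congr (_ ^+ 2).
have ikf : mu.-integrable setT (EFin \o (fun y => k y * f x)).
  rewrite (_ : _ \o _ = (fun y => (f x)%:E * (EFin \o k) y)%E); first exact: integrableZl.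
  by apply/funext => y /=; rewrite -EFinM mulrC.
have E : \int[mu]_y (k y * f (x + t * y)) =
    \int[mu]_y (k y * (f (x + t * y) - f x)) + \int[mu]_y (k y * f x).
  by rewrite -RintegralD//; apply: eq_Rintegral => y _; ring.
by rewrite /conv E RintegralZr// addrK.
Qed.

(** Integrate the pointwise Cauchy-Schwarz bound against the weight. By Tonelli the integral in [x]
    may be taken first, and it is the squared norm of the translation difference by [t * y]. *)
Lemma normW_conv_le s (k f : R -> R) t : 0 <= s ->
  mu.-integrable setT (EFin \o k) -> mfun f -> (normW s f < +oo)%E ->
  (normW s (fun x => conv k f t x - (\int[mu]_y k y) * f x)%R <=
   (\int[mu]_y `|k y| + 1)%:E *
   intR (fun y => `|k y| * fine (normW s (fun x => f (x + t * y) - f x)))%R)%E.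
Proof.
move=> s0 ik mf ff.
have mk : mfun k by have /measurable_EFinP := measurable_int _ ik.
have A0 : 0 <= \int[mu]_y `|k y| + 1 by rewrite addr_ge0//; apply: Rintegral_ge0.
pose H (z : R * R) := wt s z.1 * (`|k z.2| * (f (z.1 + t * z.2) - f z.1) ^+ 2).
have H0 z : 0 <= H z by rewrite mulr_ge0 ?wt_ge0// mulr_ge0 ?sqr_ge0.
have mH1 : mfun2 (fun z => f (z.1 + t * z.2) - f z.1).
  by apply: measurable_funB; [exact: measurable_affine2|exact: (measurableT_comp mf measurable_fst)].
have mH : mfun2 H.
  apply: measurable_funM; first exact: (measurableT_comp (measurable_wt s) measurable_fst).
  apply: measurable_funM; last exact: measurable_funX.
  apply: measurableT_comp => //; exact: (measurableT_comp mk measurable_snd).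
have mEH : measurable_fun setT (EFin \o H) by exact/measurable_EFinP.
have [C C0 HC] := normW_diff_bound s f s0 mf ff.
have dfin h : normW s (fun x => f (x + h) - f x) \is a fin_num.
  by rewrite ge0_fin_numE ?normW_ge0// (le_lt_trans (HC h))// ltry.
have mconv : mfun (fun x => conv k f t x - (\int[mu]_y k y) * f x).
  by apply: measurable_funB; [exact: measurable_conv|exact: measurable_funM].
have -> : intR (fun y => `|k y| * fine (normW s (fun x => f (x + t * y) - f x))) =
    (\int[mu]_y \int[mu]_x (EFin \o H) (x, y))%E.
  apply: eq_integral => y _; rewrite EFinM fineK//.
  rewrite /normW -intRZ//.
  - by apply: eq_integral => x _; congr EFin; rewrite /H/=; ring.
  - apply: measurable_wsqr; apply: measurable_funB => //.
    exact: (measurable_shift f (t * y) mf).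
  - by move=> x; rewrite mulr_ge0 ?wt_ge0 ?sqr_ge0.
rewrite -fubini_tonelli//.
rewrite -ge0_integralZl//; last 2 first.
- by apply: measurable_fun_fubini_tonelli_F => // z; rewrite lee_fin.
- by move=> x _; apply: integral_ge0 => y _; rewrite lee_fin.
apply: ge0_le_integral => //.
- by move=> x _; rewrite lee_fin mulr_ge0 ?wt_ge0 ?sqr_ge0.
- by apply/measurable_EFinP; exact: measurable_wsqr.
- apply: measurable_funeM.
  by apply: measurable_fun_fubini_tonelli_F => // z; rewrite lee_fin.
move=> x _.
have mx : mfun (fun y => `|k y| * (f (x + t * y) - f x) ^+ 2).
  apply: measurable_funM; first exact: measurableT_comp.
  apply: measurable_funX; apply: measurable_funB => //; apply: (measurableT_comp mf).
  by apply: measurable_funD => //; exact: measurable_funM.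
have -> : (\int[mu]_y (EFin \o H) (x, y) =
    (wt s x)%:E * intR (fun y => `|k y| * (f (x + t * y) - f x) ^+ 2)%R)%E.
  rewrite -intRZ ?wt_ge0//.
  by move=> y; rewrite mulr_ge0 ?sqr_ge0.
rewrite EFinM muleCA lee_wpmul2l ?lee_fin ?wt_ge0//.
exact: conv_sub_le.
Qed.

Lemma measurable_normW_diff s (f : R -> R) : mfun f ->
  mfun (fun h => fine (normW s (fun x => f (x + h) - f x))).
Proof.
move=> mf; apply: measurableT_comp; first exact: fine_measurable.
apply: (@measurable_fun_fubini_tonelli_F _ _ _ _ _ mu
  (fun z => (wt s z.2 * (f (z.2 + z.1) - f z.2) ^+ 2)%:E)) => //=.
- apply/measurable_EFinP; apply: measurable_funM.
    exact: (measurableT_comp (measurable_wt s) measurable_snd).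
  apply: measurable_funX; apply: measurable_funB.
    by apply: (measurableT_comp mf); exact: measurable_funD.
  exact: (measurableT_comp mf measurable_snd).
- by move=> z; rewrite lee_fin mulr_ge0 ?wt_ge0 ?sqr_ge0.
Qed.

(** Dominated convergence in [y]: each translation difference tends to [0], and for [|t n| <= 1] it
    is at most [C * wt s y]. This is why [k] must be integrable against the weight. *)
Lemma cvg_conv s (k f : R -> R) (t : nat -> R) : 0 <= s ->
  mu.-integrable setT (EFin \o k) -> (intR (fun y => wt s y * `|k y|)%R < +oo)%E ->
  mfun f -> (normW s f < +oo)%E -> t n @[n --> \oo] --> (0 : R) ->
  normW s (fun x => conv k f (t n) x - (\int[mu]_y k y) * f x) @[n --> \oo] --> 0%E.
Proof.
move=> s0 ik wk mf ff t0.
have mk : mfun k by have /measurable_EFinP := measurable_int _ ik.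
have mnk : mfun (fun y => `|k y|) by exact: measurableT_comp.
have [C C0 HC] := normW_diff_bound s f s0 mf ff.
pose A := \int[mu]_y `|k y| + 1.
have A0 : 0 < A by rewrite ltr_wpDl//; apply: Rintegral_ge0.
have K : intR (fun y => `|k y| * fine (normW s (fun x => f (x + t n * y) - f x)))
    @[n --> \oo] --> 0%E.
  apply: (@dominated_intR0 _ _ (fun y => C * (wt s y * `|k y|))).
  - move=> n; apply: measurable_funM => //.
    apply: (measurableT_comp (measurable_normW_diff s f mf)).
    exact: measurable_funM.
  - by apply: measurable_funM => //; apply: measurable_funM => //; exact: measurable_wt.
  - rewrite intRZ//.
    + by rewrite lte_mul_pinfty// lee_fin.
    + by apply: measurable_funM => //; exact: measurable_wt.
    + by move=> y; rewrite mulr_ge0// wt_ge0.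
  - by move=> n y; rewrite mulr_ge0// fine_ge0// normW_ge0.
  - near=> n => y.
    have tn : `|t n| <= 1.
      by near: n; move/cvgrPdist_le: t0 => /(_ 1 ltr01); apply: filterS => n;
        rewrite sub0r normrN.
    rewrite [leRHS]mulrA [leRHS]mulrC ler_wpM2l//.
    apply: (@le_trans _ _ (C * wt s (t n * y))).
      by rewrite -lee_fin fineK ?HC// ge0_fin_numE ?normW_ge0// (le_lt_trans (HC _))// ltry.
    by rewrite ler_wpM2l// wt_homo// normrM ler_piMl.
  - apply: aeW => y; rewrite -(mulr0 `|k y|); apply: cvgM; first exact: cvg_cst.
    have ty : t n * y @[n --> \oo] --> (0 : R).
      by rewrite -(mul0r y); apply: cvgM => //; exact: cvg_cst.
    exact: (fine_cvg (translation_cvg_normW s f s0 mf ff _ ty)).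
apply/cvge0P => [n|e e0]; first exact: normW_ge0.
have eA : 0 < e / A by rewrite divr_gt0.
have K0 n : (0 <= intR (fun y => `|k y| * fine (normW s (fun x => f (x + t n * y) - f x)))%R)%E.
  by apply: intR_ge0 => y; rewrite mulr_ge0// fine_ge0// normW_ge0.
have := (cvge0P _ K0).1 K _ eA; apply: filterS => n le.
apply: (le_trans (normW_conv_le s k f (t n) s0 ik mf ff)).
have -> : e = A * (e / A) by rewrite mulrC divfK// lt0r_neq0.
by rewrite (EFinM A) lee_wpmul2l// lee_fin ltW.
Unshelve. all: by end_near. Qed.

End convolution.

(** * The kernels of intervals *)

Section kernel_of_intervals.
Context {R : realType}.
Notation mu := (@lebesgue_measure R).
Local Notation mfun f := (measurable_fun (setT : set R) (f : R -> R)).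

(** Measurability of powers is transferred through [x^-1 = x (x^2)^-1], an identity that also holds
    at [0], where both sides are [0]. *)
Lemma measurable_invr : mfun (@GRing.inv R).
Proof.
rewrite (_ : GRing.inv = (fun x : R => x * (x ^+ 2) `^ (-1))).
  apply: measurable_funM => //; apply: (measurableT_comp (measurable_powR _)).
  exact: measurable_funX.
apply/funext => x; have [->|x0] := eqVneq x 0; first by rewrite invr0 mul0r.
by rewrite powR_inv1 ?sqr_ge0//; field.
Qed.

Lemma derive_le1_lipschitz (f f' : R -> R) (x y : R) : (forall z : R, is_derive z 1 f (f' z)) ->
  (forall z, `|f' z| <= 1) -> `|f x - f y| <= `|x - y|.
Proof.
move=> df f1.
wlog xy : x y / y < x.
  move=> H; have [yx|xy|->] := ltgtP y x; [exact: H| |by rewrite !subrr].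
  by rewrite distrC [leRHS]distrC; exact: H.
have cf : {within `[y, x], continuous f}.
  apply: continuous_subspaceT => z; apply: derivable1_continuous.
  exact: (@ex_derive _ _ _ _ _ _ _ (df z)).
have [c _ ->] := MVT xy (fun z _ => df z) cf.
by rewrite normrM ler_piMl.
Qed.

Lemma trig_lipschitz (b : R -> R) (x y : R) : trig b -> `|b x - b y| <= `|x - y|.
Proof.
case=> ->; apply: derive_le1_lipschitz => z.
- by rewrite normrN; apply: (@trig_le1 _ sin); right.
- by apply: (@trig_le1 _ cos); left.
Qed.

(** The two summands of [1 + x^2] are bounded separately: the Lipschitz bound on the numerator gives
    [(a2 - a1)^2], and the trivial bound [2] on it, against [2 pi], gives [1]. *)
Lemma osc_quotient_le (b : R -> R) (a1 a2 x : R) : trig b -> x != 0 ->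
  ((b (2 * pi * x * a2) - b (2 * pi * x * a1)) / (2 * pi * x)) ^+ 2 * (1 + x ^+ 2) <=
  (a2 - a1) ^+ 2 + 1.
Proof.
move=> tb x0; set D := b _ - b _; set q := 2 * pi * x.
have pi2 := pi_ge2 R.
have q0 : q != 0 by rewrite /q !mulf_neq0// lt0r_neq0// pi_gt0.
rewrite mulrDr mulr1; apply: lerD.
  have : `|D| <= `|q| * `|a2 - a1| by rewrite -normrM mulrBr; exact: trig_lipschitz.
  rewrite -ler_pdivrMl ?normr_gt0// mulrC -normfV -normrM => H.
  by rewrite -real_normK ?num_real// -[leRHS]real_normK ?num_real// lerXn2r ?nnegrE.
have D2 : `|D| <= 2.
  apply: (le_trans (ler_normB _ _)); rewrite -[leRHS]/(1 + 1).
  by apply: lerD; exact: trig_le1.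
have -> : (D / q) ^+ 2 * x ^+ 2 = (D / (2 * pi)) ^+ 2.
  by rewrite -exprMn /q invfM -!mulrA mulVf// mulr1.
rewrite -real_normK ?num_real// exprn_ile1// normrM normfV.
rewrite ler_pdivrMr ?normr_gt0 ?mulf_neq0 ?lt0r_neq0 ?pi_gt0// mul1r.
by apply: (le_trans D2); rewrite ger0_norm; lra.
Qed.

Lemma kern_bound (a b x : R) :
  (kern a b x).1 ^+ 2 <= ((b - a) ^+ 2 + 1) * (1 + x ^+ 2)^-1 /\
  (kern a b x).2 ^+ 2 <= ((b - a) ^+ 2 + 1) * (1 + x ^+ 2)^-1.
Proof.
rewrite !ler_pdivlMr ?onePsqr_gt0// /kern; have [->|x0] := eqVneq x 0.
  by split; rewrite /= ?expr0n/= ?addr0 ?mulr1 ?mul0r ?lerDl ?addr_ge0 ?sqr_ge0.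
by split; apply: osc_quotient_le => //; [right|left].
Qed.

Lemma measurable_kern (a b : R) :
  mfun (fun x => (kern a b x).1) /\ mfun (fun x => (kern a b x).2).
Proof.
have mq (c : R -> R) : trig c -> mfun (fun x => (c (2 * pi * x * b) - c (2 * pi * x * a)) / (2 * pi * x)).
  move=> tc; have mc : mfun c by apply: continuous_measurable_fun; exact: trig_continuous.
  apply: measurable_funM.
    by apply: measurable_funB; apply: measurableT_comp => //; apply: measurable_funM => //;
      exact: measurable_funM.
  by apply: (measurableT_comp measurable_invr); exact: measurable_funM.
have m0 : measurable_fun (setT : set R) (fun x : R => x == 0).
  exact: measurable_fun_eqr.
split.
  rewrite (_ : (fun x => _) = (fun x => if x == 0 then b - a else
    (sin (2 * pi * x * b) - sin (2 * pi * x * a)) / (2 * pi * x))).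
    by apply: measurable_fun_ifT => //; apply: mq; right.
  by apply/funext => x; rewrite /kern; case: ifP.
rewrite (_ : (fun x => _) = (fun x => if x == 0 then 0 else
    (cos (2 * pi * x * b) - cos (2 * pi * x * a)) / (2 * pi * x))).
  by apply: measurable_fun_ifT => //; apply: mq; left.
by apply/funext => x; rewrite /kern; case: ifP.
Qed.

(** Real and imaginary parts of [kern (a + h) (b + h) x = exp(-2 pi i x h) kern a b x]. *)
Lemma kern_shift (a b h x : R) (c := cos (2 * pi * (x * h))) (s := sin (2 * pi * (x * h))) :
  (kern (a + h) (b + h) x).1 = c * (kern a b x).1 + s * (kern a b x).2 /\
  (kern (a + h) (b + h) x).2 = c * (kern a b x).2 - s * (kern a b x).1.
Proof.
rewrite /kern; have [x0|x0] := eqVneq x 0.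
  rewrite /c /s x0 mul0r mulr0 cos0 sin0 /= mul1r !mul0r mulr0 addr0 subr0.
  by split => //; ring.
have E y : 2 * pi * x * (y + h) = 2 * pi * x * y + 2 * pi * (x * h) by ring.
by rewrite !E !sinD !cosD -/c -/s /=; split; ring.
Qed.

Lemma sqr_integrable_mul (f g : R -> R) : mfun f -> mfun g ->
  (intR (fun x => f x ^+ 2)%R < +oo)%E -> (intR (fun x => g x ^+ 2)%R < +oo)%E ->
  mu.-integrable setT (EFin \o (fun x => f x * g x)).
Proof.
move=> mf mg f2 g2.
have mf2 : mfun (fun x => f x ^+ 2) by exact: measurable_funX.
have mg2 : mfun (fun x => g x ^+ 2) by exact: measurable_funX.
apply/integrableP; split; first by apply/measurable_EFinP; exact: measurable_funM.
apply: (@le_lt_trans _ _ (intR (fun x => f x ^+ 2 + g x ^+ 2))); last first.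
  rewrite intRD//; last 2 first.
  - by move=> x; rewrite sqr_ge0.
  - by move=> x; rewrite sqr_ge0.
  by rewrite lte_add_pinfty.
apply: le_intR => //.
- by apply: measurableT_comp => //; exact: measurable_funM.
- exact: measurable_funD.
move=> x; rewrite normrM -(real_normK (num_real (f x))) -(real_normK (num_real (g x))).
by have := sqr_ge0 (`|f x| - `|g x|); have := mulr_ge0 (normr_ge0 (f x)) (normr_ge0 (g x)); nra.
Qed.

Lemma L2_components (u : R -> R * R) : L2 u ->
  [/\ mfun (fun x => (u x).1), mfun (fun x => (u x).2),
      (intR (fun x => (u x).1 ^+ 2)%R < +oo)%E & (intR (fun x => (u x).2 ^+ 2)%R < +oo)%E].
Proof.
move=> [m1 [m2 i]].
have i' : (intR (fun x => cnorm2 (u x)) < +oo)%E.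
  have /integrableP[_] := i; apply: le_lt_trans.
  apply: le_intR => //.
  - by apply: measurable_funD; exact: measurable_funX.
  - apply: measurableT_comp => //; apply: measurable_funD; exact: measurable_funX.
  - by move=> x; rewrite addr_ge0 ?sqr_ge0.
  - by move=> x; rewrite ler_norm.
split => //; apply: le_lt_trans i'; apply: le_intR => //.
- exact: measurable_funX.
- by apply: measurable_funD; exact: measurable_funX.
- by move=> x; rewrite sqr_ge0.
- by move=> x; rewrite lerDl sqr_ge0.
- exact: measurable_funX.
- by apply: measurable_funD; exact: measurable_funX.
- by move=> x; rewrite sqr_ge0.
- by move=> x; rewrite lerDr sqr_ge0.
Qed.

Lemma kern_sqr_integrable (a b : R) :
  (intR (fun x => (kern a b x).1 ^+ 2)%R < +oo)%E /\
  (intR (fun x => (kern a b x).2 ^+ 2)%R < +oo)%E.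
Proof.
have [m1 m2] := measurable_kern a b.
have mV : mfun (fun x => (1 + x ^+ 2)^-1).
  by apply: continuous_measurable_fun; exact: continuous_oneDsqrV.
have H : (intR (fun x => ((b - a) ^+ 2 + 1) * (1 + x ^+ 2)^-1)%R < +oo)%E.
  rewrite intRZ//.
  - by rewrite intR_oneDsqrV -EFinM ltry.
  - by rewrite addr_ge0 ?sqr_ge0.
  - by move=> x; rewrite invr_ge0 ltW// onePsqr_gt0.
split; apply: le_lt_trans H; apply: le_intR.
- exact: measurable_funX.
- exact: measurable_funM.
- by move=> x; rewrite sqr_ge0.
- by move=> x; case: (kern_bound a b x).
- exact: measurable_funX.
- exact: measurable_funM.
- by move=> x; rewrite sqr_ge0.
- by move=> x; case: (kern_bound a b x).
Qed.

Lemma integrable_cmul_kern (u : R -> R * R) (a b : R) : L2 u ->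
  mu.-integrable setT (EFin \o (fun x => (cmul (u x) (kern a b x)).1)) /\
  mu.-integrable setT (EFin \o (fun x => (cmul (u x) (kern a b x)).2)).
Proof.
move=> /L2_components[m1 m2 i1 i2].
have [k1 k2] := measurable_kern a b; have [j1 j2] := kern_sqr_integrable a b.
have i11 := sqr_integrable_mul _ _ m1 k1 i1 j1.
have i12 := sqr_integrable_mul _ _ m1 k2 i1 j2.
have i21 := sqr_integrable_mul _ _ m2 k1 i2 j1.
have i22 := sqr_integrable_mul _ _ m2 k2 i2 j2.
split.
  have := integrableB measurableT i11 i22.
  by congr (mu.-integrable setT _); apply/funext.
have := integrableD measurableT i12 i21.
by congr (mu.-integrable setT _); apply/funext.
Qed.

Lemma sqr_integrable_itv (f : R -> R) (a b : R) : mfun f ->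
  (intR (fun x => f x ^+ 2)%R < +oo)%E -> mu.-integrable `[a, b] (EFin \o f).
Proof.
move=> mf f2.
pose g := fun x : R => \1_(`[a, b]%classic) x : R.
have mg : mfun g by exact: measurable_indic.
have g2 : (intR (fun x => g x ^+ 2)%R < +oo)%E.
  rewrite (_ : (fun x => _) = g); last first.
    by apply/funext => x; rewrite /g indicE; case: (_ \in _); rewrite ?expr1n ?expr0n.
  rewrite /intR /g integral_indic//= setIT lebesgue_measure_itv/=.
  by case: ifP => _; rewrite ?ltry// -EFinB ltry.
apply/integrable_mkcond => //.
apply: eq_integrable (sqr_integrable_mul _ _ mf mg f2 g2) => // x _ /=.
by rewrite patchE /g indicE; case: ifP => _; rewrite ?mulr1 ?mulr0.
Qed.

End kernel_of_intervals.

(** * The transform of a product with a cut-off *)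

Section fourier_transform_of_product.
Context {R : realType}.
Notation mu := (@lebesgue_measure R).
Local Notation mfun f := (measurable_fun (setT : set R) (f : R -> R)).
Local Notation mfun2 f := (measurable_fun (setT : set (R * R)) (f : R * R -> R)).
Local Notation ind a b := (\1_(`[a, b]%classic) : R -> R).

Lemma Rintegral_ind (f : R -> R) (a b : R) :
  \int[mu]_(x in `[a, b]) f x = \int[mu]_x (ind a b x * f x).
Proof.
rewrite Rintegral_mkcond; apply: eq_Rintegral => x _.
by rewrite patchE indicE; case: ifP => _; rewrite ?mul1r ?mul0r.
Qed.

Lemma integrable_ind (f : R -> R) (a b : R) :
  mu.-integrable setT (EFin \o (fun x => ind a b x * f x)) <->
  mu.-integrable `[a, b] (EFin \o f).
Proof.
have -> : EFin \o (fun x => ind a b x * f x) = (EFin \o f) \_ `[a, b].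
  apply/funext => x /=; rewrite patchE indicE.
  by case: ifP => _; rewrite ?mul1r ?mul0r.
by rewrite -integrable_mkcond.
Qed.

Lemma ind_shift (a b h x : R) : ind (a + h) (b + h) (x + h) = ind a b x.
Proof.
rewrite !indicE; congr (nat_of_bool _)%:R.
by apply/idP/idP; rewrite !inE/= !in_itv/= !lerD2r.
Qed.

Lemma Rintegral_itv_shift (f : R -> R) (a b h : R) : mfun f ->
  \int[mu]_x (ind a b x * f (x + h)) = \int[mu]_(x in `[a + h, b + h]) f x.
Proof.
move=> mf; rewrite Rintegral_ind /Rintegral; congr fine.
rewrite -[RHS](integral_addr h).
  by apply: eq_integral => x _; rewrite ind_shift.
by apply/measurable_EFinP; apply: measurable_funM => //; exact: measurable_indic.
Qed.

Lemma intR_ind_lty (a b : R) : (intR (ind a b) < +oo)%E.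
Proof.
rewrite /intR integral_indic//= setIT lebesgue_measure_itv/=.
by case: ifP => _; rewrite ?ltry// -EFinB ltry.
Qed.

Lemma ind_ge0 (a b x : R) : 0 <= ind a b x.
Proof. by rewrite indicE. Qed.

(** From [|f| <= 1 + f^2]. The bound does not depend on [h], so it stays integrable against [|k y|]
    when [h = t y]. *)
Lemma intR_ind_norm_le (f : R -> R) (a b h : R) : mfun f ->
  (intR (fun x => ind a b x * `|f (x + h)|)%R <= intR (ind a b) + intR (fun x => f x ^+ 2)%R)%E.
Proof.
move=> mf.
have mi : mfun (ind a b) by exact: measurable_indic.
have mf2 : mfun (fun x => f x ^+ 2) by exact: measurable_funX.
have <- : intR (fun x => f (x + h) ^+ 2) = intR (fun x => f x ^+ 2).
  rewrite /intR -[RHS](ge0_integral_addr h)//; first exact/measurable_EFinP.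
  by move=> x; rewrite lee_fin sqr_ge0.
have mfh := measurable_shift f h mf.
rewrite -intRD//.
- apply: le_intR.
  + by apply: measurable_funM => //; exact: measurableT_comp.
  + by apply: measurable_funD => //; exact: measurable_funX.
  + by move=> x; rewrite mulr_ge0// ind_ge0.
  move=> x; rewrite -(real_normK (num_real (f (x + h)))) indicE.
  case: (_ \in _); rewrite ?mul1r ?mul0r/= ?add0r ?sqr_ge0//.
  have := sqr_ge0 (`|f (x + h)| - 1); have := sqr_ge0 `|f (x + h)|; nra.
- exact: measurable_funX.
- by move=> x; rewrite sqr_ge0.
Qed.

(** Fubini on [[a, b]] times the line. Integrating a translate of [f] over [[a, b]] amounts to
    integrating [f] over the translated interval, the only kind of integral of a transform that
    [is_FT] can evaluate. *)
Lemma conv_itv (k f : R -> R) (t a b : R) :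
  mu.-integrable setT (EFin \o k) -> mfun f -> (intR (fun x => f x ^+ 2)%R < +oo)%E ->
  mu.-integrable `[a, b] (EFin \o conv k f t) /\
  \int[mu]_(x in `[a, b]) conv k f t x =
  \int[mu]_y (k y * \int[mu]_(x in `[a + t * y, b + t * y]) f x).
Proof.
move=> ik mf f2.
have mk : mfun k by have /measurable_EFinP := measurable_int _ ik.
have mi : mfun (ind a b) by exact: measurable_indic.
pose h (z : R * R) := ind a b z.1 * (k z.2 * f (z.1 + t * z.2)).
have mh : mfun2 h.
  apply: measurable_funM; first exact: (measurableT_comp mi measurable_fst).
  apply: measurable_funM; first exact: (measurableT_comp mk measurable_snd).
  exact: measurable_affine2.
pose M := (intR (ind a b) + intR (fun x => f x ^+ 2)%R)%E.
have M0' : (0 <= M)%E by apply: adde_ge0; apply: intR_ge0 => x; rewrite ?ind_ge0 ?sqr_ge0.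
have Mfin : M \is a fin_num by rewrite ge0_fin_numE// lte_add_pinfty// intR_ind_lty.
have M0 : 0 <= fine M by rewrite fine_ge0.
have mEh : measurable_fun setT (EFin \o h) by exact/measurable_EFinP.
have ih : (mu \x mu)%E.-integrable setT (EFin \o h).
  apply/integrable21ltyP => //.
  apply: (@le_lt_trans _ _ (intR (fun y => fine M * `|k y|))); last first.
    rewrite intRZ//; last by exact: measurableT_comp.
    by rewrite lte_mul_pinfty ?lee_fin//; exact: intR_integrable.
  apply: ge0_le_integral => //.
  - by move=> y _; apply: integral_ge0 => x _; exact: abse_ge0.
  - apply: (@measurable_fun_fubini_tonelli_G _ _ _ _ _ mu (abse \o (EFin \o h))) => //.
    by apply: measurableT_comp.
  - by move=> z; exact: abse_ge0.
  - apply/measurable_EFinP; apply: measurable_funM => //; exact: measurableT_comp.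
  move=> y _; rewrite mulrC EFinM fineK//.
  have := lee_wpmul2l (_ : (0 <= `|k y|%:E)%E) (intR_ind_norm_le f a b (t * y) mf).
  rewrite lee_fin normr_ge0 => /(_ isT); apply: le_trans.
  rewrite -intRZ//.
  - rewrite le_eqVlt; apply/orP; left; apply/eqP; apply: eq_integral => x _ /=.
    by congr EFin; rewrite /h/= !normrM (ger0_norm (ind_ge0 _ _ _)) mulrCA.
  - apply: measurable_funM => //; apply: measurableT_comp => //.
    exact: (measurable_shift f (t * y)).
pose Fh := fun x : R => (\int[mu]_y (EFin \o h) (x, y))%E.
have iF : mu.-integrable setT Fh := integrable_fubini_F ih.
have FE x : x \in `[a, b]%classic -> Fh x = (\int[mu]_y (k y * f (x + t * y))%:E)%E.
  by move=> xab; apply: eq_integral => y _ /=; rewrite /h/= indicE xab mul1r.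
have FE0 x : x \in `[a, b]%classic = false -> Fh x = 0%E.
  move=> xab; rewrite /Fh; under eq_integral do rewrite /= /h/= indicE xab mul0r.
  exact: integral0.
have mc := measurable_conv k f t mk mf.
have ic : mu.-integrable setT (EFin \o (fun x => ind a b x * conv k f t x)).
  apply: le_integrable iF => //.
    by apply/measurable_EFinP; exact: measurable_funM.
  move=> x _ /=; rewrite indicE; case: (boolP (_ \in _)) => xab.
    by rewrite mul1r FE// /conv /Rintegral; case: (\int[mu]_y _)%E => [r| |] //=; rewrite leey.
  by rewrite mul0r normr0; exact: abse_ge0.
split; first exact/integrable_ind.
rewrite Rintegral_ind.
apply: (@congr1 _ _ fine _
  (\int[mu]_y (k y * \int[mu]_(x in `[a + t * y, b + t * y]) f x)%:E)%E).
transitivity (\int[mu]_x Fh x)%E.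
  (* The section integral may fail to be finite on a null set, where [conv] takes the default value
     of [fine]; the two functions agree only almost everywhere. *)
  apply: ae_eq_integral => //.
  - by apply/measurable_EFinP; exact: measurable_funM.
  - exact: (measurable_int _ iF).
  apply: ae_impl (integrable_ae measurableT iF) => x /(_ I) Fx _.
  rewrite /= indicE; case: (boolP (_ \in _)) => xab.
    by rewrite mul1r; move: Fx; rewrite FE// => Fx; rewrite /conv /Rintegral fineK.
  by rewrite mul0r FE0//; exact: negbTE.
rewrite (Fubini ih); apply: eq_integral => y _ /=.
rewrite -Rintegral_itv_shift//.
have if1 : mu.-integrable setT (EFin \o (fun x => ind a b x * f (x + t * y))).
  apply/integrable_ind; apply: sqr_integrable_itv; first exact: measurable_shift.
  rewrite (_ : intR _ = intR (fun x => f x ^+ 2))//.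
  rewrite /intR -[RHS](ge0_integral_addr (t * y))//.
    by apply/measurable_EFinP; exact: measurable_funX.
  by move=> x; rewrite lee_fin sqr_ge0.
rewrite EFinM /Rintegral fineK ?integrable_fin_num// -integralZl//.
by apply: eq_integral => x _; rewrite -EFinM; congr EFin; rewrite /h/=; ring.
Qed.

Lemma Fubini_trig (b k P : R -> R) t : trig b ->
  mu.-integrable setT (EFin \o k) -> mu.-integrable setT (EFin \o P) ->
  [/\ mu.-integrable setT (EFin \o (fun y => k y * \int[mu]_x (P x * b (2 * pi * (x * (t * y)))))),
      mu.-integrable setT (EFin \o (fun x => P x * \int[mu]_y (k y * b (2 * pi * (x * t) * y)))) &
      \int[mu]_y (k y * \int[mu]_x (P x * b (2 * pi * (x * (t * y))))) =
      \int[mu]_x (P x * \int[mu]_y (k y * b (2 * pi * (x * t) * y)))].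
Proof.
move=> tb ik iP.
have m1 : mfun2 (fun z => b (2 * pi * (z.2 * (t * z.1)))).
  apply: measurableT_comp; first by apply: continuous_measurable_fun; exact: trig_continuous.
  by apply: measurable_funM => //; apply: measurable_funM => //; exact: measurable_funM.
have m2 : mfun2 (fun z => b (2 * pi * (z.1 * t) * z.2)).
  apply: measurableT_comp; first by apply: continuous_measurable_fun; exact: trig_continuous.
  by apply: measurable_funM => //; apply: measurable_funM => //; exact: measurable_funM.
split.
- exact: (integrable_bounded_param k P _ ik iP m1 (fun z => trig_le1 _ _ tb)).
- exact: (integrable_bounded_param P k _ iP ik m2 (fun z => trig_le1 _ _ tb)).
- rewrite (Fubini_bounded k P _ ik iP m1 (fun z => trig_le1 _ _ tb)).
  apply: eq_Rintegral => x _; congr (_ * _); apply: eq_Rintegral => y _ /=.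
  by congr (_ * b _); ring.
Qed.

Lemma integrable_trigM (b P : R -> R) (h : R) : trig b -> mu.-integrable setT (EFin \o P) ->
  mu.-integrable setT (EFin \o (fun x => P x * b (2 * pi * (x * h)))).
Proof.
move=> tb iP; have mP : mfun P by have /measurable_EFinP := measurable_int _ iP.
apply: le_integrable iP => //=.
  apply/measurable_EFinP; apply: measurable_funM => //; apply: measurableT_comp.
    by apply: continuous_measurable_fun; exact: trig_continuous.
  by apply: measurable_funM => //; exact: measurable_funM.
by move=> x _; rewrite lee_fin normrM ler_piMr// trig_le1.
Qed.

(** By [kern_shift], moving the interval by [h] multiplies [u * kern a b] by [exp(-2 pi i x h)]; the
    two equalities are its real and imaginary parts. *)
Lemma is_FT_shift (u U : R -> R * R) (a b h : R) : L2 u -> is_FT u U -> a < b ->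
  \int[mu]_(x in `[a + h, b + h]) (U x).1 =
    \int[mu]_x ((cmul (u x) (kern a b x)).1 * cos (2 * pi * (x * h))) +
    \int[mu]_x ((cmul (u x) (kern a b x)).2 * sin (2 * pi * (x * h))) /\
  \int[mu]_(x in `[a + h, b + h]) (U x).2 =
    \int[mu]_x ((cmul (u x) (kern a b x)).2 * cos (2 * pi * (x * h))) -
    \int[mu]_x ((cmul (u x) (kern a b x)).1 * sin (2 * pi * (x * h))).
Proof.
move=> u2 [_ FT] ab.
have [i1 i2] := integrable_cmul_kern u a b u2.
have abh : a + h < b + h by rewrite ltrD2r.
have [-> ->] := FT _ _ abh.
have tc : trig (@cos R) by left.
have ts : trig (@sin R) by right.
have i1c := integrable_trigM cos _ h tc i1.
have i1s := integrable_trigM sin _ h ts i1.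
have i2c := integrable_trigM cos _ h tc i2.
have i2s := integrable_trigM sin _ h ts i2.
rewrite -RintegralD// -RintegralB//.
split; apply: eq_Rintegral => x _; have [k1 k2] := kern_shift a b h x;
  by rewrite /cmul/= k1 k2; ring.
Qed.

(** The left side is the real part of the integral of [k(y) (P + i Q)(x) exp(-2 pi i x t y)] in both
    variables. After Fubini [P] meets the real part of the inversion formula, which is [chi (x t)],
    and [Q] meets its imaginary part, which is [0]. *)
Lemma fourier_inversion_pairing (chi P Q : R -> R) (t : R)
    (kc := ftrig cos chi) (ks := ftrig sin chi) :
  bump chi -> (forall x, 0 <= chi x <= 1) ->
  mu.-integrable setT (EFin \o P) -> mu.-integrable setT (EFin \o Q) ->
  \int[mu]_y (kc y * (\int[mu]_x (P x * cos (2 * pi * (x * (t * y)))) +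
                      \int[mu]_x (Q x * sin (2 * pi * (x * (t * y)))))) -
  \int[mu]_y (ks y * (\int[mu]_x (Q x * cos (2 * pi * (x * (t * y)))) -
                      \int[mu]_x (P x * sin (2 * pi * (x * (t * y)))))) =
  \int[mu]_x (P x * chi (x * t)).
Proof.
move=> bc c01 iP iQ.
have tc : trig (@cos R) by left.
have ts : trig (@sin R) by right.
have ikc : mu.-integrable setT (EFin \o kc) := integrable_ftrig cos chi tc bc.
have iks : mu.-integrable setT (EFin \o ks) := integrable_ftrig sin chi ts bc.
have itr b k x : trig b -> mu.-integrable setT (EFin \o k) ->
    mu.-integrable setT (EFin \o (fun y => k y * b (2 * pi * (x * t) * y))).
  move=> tb ik; have := integrable_trigM b _ (x * t) tb ik.
  by congr (mu.-integrable setT _); apply/funext => y /=; congr (_ * b _)%:E; ring.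
have chiE x : \int[mu]_y (kc y * cos (2 * pi * (x * t) * y)) +
    \int[mu]_y (ks y * sin (2 * pi * (x * t) * y)) = chi (x * t).
  by rewrite -(fourier_inversion (x * t) chi bc c01) -RintegralD//; exact: itr.
have zeroE x : \int[mu]_y (kc y * sin (2 * pi * (x * t) * y)) -
    \int[mu]_y (ks y * cos (2 * pi * (x * t) * y)) = 0.
  by rewrite -(fourier_inversion_im (x * t) chi bc) -RintegralB//; exact: itr.
have [ccP1 ccP2 ccP] := Fubini_trig cos kc P t tc ikc iP.
have [csQ1 csQ2 csQ] := Fubini_trig sin kc Q t ts ikc iQ.
have [scQ1 scQ2 scQ] := Fubini_trig cos ks Q t tc iks iQ.
have [ssP1 ssP2 ssP] := Fubini_trig sin ks P t ts iks iP.
under eq_Rintegral do rewrite mulrDr.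
under [X in _ - X]eq_Rintegral do rewrite mulrBr.
rewrite (RintegralD measurableT ccP1 csQ1) (RintegralB measurableT scQ1 ssP1) ccP csQ scQ ssP.
have alg (p q r s : R) : p + q - (r - s) = p + s + (q - r) by ring.
rewrite alg -(RintegralD measurableT ccP2 ssP2) -(RintegralB measurableT csQ2 scQ2).
rewrite [X in _ + X](_ : _ = 0) ?addr0; last first.
  under eq_Rintegral do rewrite -mulrBr zeroE mulr0.
  by rewrite /Rintegral integral0.
by apply: eq_Rintegral => x _; rewrite -mulrDr chiE.
Qed.

(** Both sides have the same integral over every interval: [P + i Q] is taken to be [u * kern a b],
    and the inner integrals are those of [U] over translated intervals. *)
Lemma is_FT_mul_conv (u U V : R -> R * R) (chi : R -> R) (t : R) :
  L2 u -> is_FT u U -> bump chi -> (forall x, 0 <= chi x <= 1) ->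
  is_FT (rmulf (fun x => chi (x * t)) u) V ->
  {ae mu, forall x, (V x).1 = conv (ftrig cos chi) (fun x => (U x).1) t x -
                              conv (ftrig sin chi) (fun x => (U x).2) t x} /\
  {ae mu, forall x, (V x).2 = conv (ftrig cos chi) (fun x => (U x).2) t x +
                              conv (ftrig sin chi) (fun x => (U x).1) t x}.
Proof.
move=> u2 FTu bc c01 FTv.
have [V2 Vint] := FTv; have [U2 _] := FTu.
have [mV1 mV2 iV1 iV2] := L2_components V V2.
have [mU1 mU2 iU1 iU2] := L2_components U U2.
have ikc := integrable_ftrig cos chi (or_introl erefl) bc.
have iks := integrable_ftrig sin chi (or_intror erefl) bc.
have mkc : mfun (ftrig cos chi) by have /measurable_EFinP := measurable_int _ ikc.
have mks : mfun (ftrig sin chi) by have /measurable_EFinP := measurable_int _ iks.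
have c11 a b := conv_itv _ _ t a b ikc mU1 iU1.
have s22 a b := conv_itv _ _ t a b iks mU2 iU2.
have c12 a b := conv_itv _ _ t a b ikc mU2 iU2.
have s21 a b := conv_itv _ _ t a b iks mU1 iU1.
split; apply: eq_itv_integral_ae => //.
- by move=> a b; exact: sqr_integrable_itv.
- move=> a b; have [C1 _] := c11 a b; have [S1 _] := s22 a b.
  have := (fun m => integrableB m C1 S1) (measurable_itv _).
  by congr (mu.-integrable _ _); apply/funext.
- by apply: measurable_funB; exact: measurable_conv.
- move=> a b ab; have [j1 j2] := integrable_cmul_kern u a b u2.
  have [C1 C2] := c11 a b; have [S1 S2] := s22 a b.
  rewrite (RintegralB _ C1 S1)// C2 S2.
  have := congr1 fst (Vint a b ab); rewrite /cint /= => ->.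
  transitivity (\int[mu]_x ((cmul (u x) (kern a b x)).1 * chi (x * t))).
    by apply: eq_Rintegral => x _; rewrite /rmulf /cscale /cmul; cbn [fst snd]; ring.
  rewrite -(fourier_inversion_pairing chi _ _ t bc c01 j1 j2).
  congr (_ - _); apply: eq_Rintegral => y _.
    by have [-> _] := is_FT_shift u U a b (t * y) u2 FTu ab.
  by have [_ ->] := is_FT_shift u U a b (t * y) u2 FTu ab.
- by move=> a b; exact: sqr_integrable_itv.
- move=> a b; have [C1 _] := c12 a b; have [S1 _] := s21 a b.
  have := (fun m => integrableD m C1 S1) (measurable_itv _).
  by congr (mu.-integrable _ _); apply/funext.
- by apply: measurable_funD; exact: measurable_conv.
- move=> a b ab; have [j1 j2] := integrable_cmul_kern u a b u2.
  have [C1 C2] := c12 a b; have [S1 S2] := s21 a b.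
  rewrite (RintegralD _ C1 S1)// C2 S2.
  have := congr1 snd (Vint a b ab); rewrite /cint /= => ->.
  transitivity (\int[mu]_x ((cmul (u x) (kern a b x)).2 * chi (x * t))).
    by apply: eq_Rintegral => x _; rewrite /rmulf /cscale /cmul; cbn [fst snd]; ring.
  (* The imaginary part of a number is the real part of [- i] times it, so the real-part identity is
     reused with [(Q, - P)] in place of [(P, Q)]. *)
  have j1N : mu.-integrable setT (EFin \o (fun x => - (cmul (u x) (kern a b x)).1)).
    have := integrableN j1; by congr (mu.-integrable _ _); apply/funext.
  rewrite -(fourier_inversion_pairing chi _ _ t bc c01 j2 j1N).
  have neg b' h : trig b' -> \int[mu]_x (- (cmul (u x) (kern a b x)).1 * b' (2 * pi * (x * h))) =
      - \int[mu]_x ((cmul (u x) (kern a b x)).1 * b' (2 * pi * (x * h))).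
    move=> tb; rewrite -[RHS]mulN1r -RintegralZl//; last exact: integrable_trigM.
    by apply: eq_Rintegral => x _; rewrite mulN1r mulNr.
  congr (_ + _).
    apply: eq_Rintegral => y _; have [_ ->] := is_FT_shift u U a b (t * y) u2 FTu ab.
    by rewrite neg//; right.
  have [sc1 _ _] := Fubini_trig cos _ _ t (or_introl erefl) iks j1.
  have [ss1 _ _] := Fubini_trig sin _ _ t (or_intror erefl) iks j2.
  have sI : mu.-integrable setT (EFin \o (fun y => ftrig sin chi y *
      (\int[mu]_x (- (cmul (u x) (kern a b x)).1 * cos (2 * pi * (x * (t * y)))) -
       \int[mu]_x ((cmul (u x) (kern a b x)).2 * sin (2 * pi * (x * (t * y))))))).
    have := integrableN (integrableD measurableT sc1 ss1).
    congr (mu.-integrable _ _); apply/funext => y /=.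
    by rewrite neg; [congr EFin; ring|left].
  rewrite -mulN1r -RintegralZl//.
  apply: eq_Rintegral => y _; have [-> _] := is_FT_shift u U a b (t * y) u2 FTu ab.
  by rewrite neg; [ring|left].
Qed.

End fourier_transform_of_product.

(** * Smoothness of squares and complements *)

Section smooth_algebra.
Context {R : realType}.

(** Finite order makes an induction possible: by the product rule, order [n + 1] for [f g] reduces
    to order [n] for [f g'] and [g f'], whose factors have order [n]. *)
Definition smoothn (n : nat) (f : R -> R) :=
  forall k (x : R), (k <= n)%N -> derivable (derive1n k f) x 1.

Lemma smoothnS n f : smoothn n.+1 f <->
  (forall x : R, derivable f x 1) /\ smoothn n (derive1 f).
Proof.
split=> [H|[H0 H] [|k] x kn].
- by split=> [x|k x kn]; [exact: (H 0%N)|have := H k.+1 x kn; rewrite /derive1n iterSr].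
- exact: H0.
- by rewrite /derive1n iterSr; exact: H.
Qed.

Lemma smoothn_leS n f : smoothn n.+1 f -> smoothn n f.
Proof. by move=> H k x kn; apply: H; exact: leqW. Qed.

Lemma smoothnD n f g : smoothn n f -> smoothn n g -> smoothn n (fun x => f x + g x).
Proof.
elim: n f g => [|n IH] f g.
  by move=> F G [|//] x _; apply: derivableD; [exact: (F 0%N)|exact: (G 0%N)].
move=> /smoothnS[df F] /smoothnS[dg G]; apply/smoothnS; split.
  by move=> x; exact: derivableD.
rewrite (_ : derive1 _ = (fun x => derive1 f x + derive1 g x)); first exact: IH.
by apply/funext => x; rewrite !derive1E deriveD.
Qed.

Lemma smoothnM n f g : smoothn n f -> smoothn n g -> smoothn n (fun x => f x * g x).
Proof.
elim: n f g => [|n IH] f g.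
  by move=> F G [|//] x _; apply: derivableM; [exact: (F 0%N)|exact: (G 0%N)].
move=> sf sg; have := sf; have := sg.
move=> /smoothnS[dg G] /smoothnS[df F]; apply/smoothnS; split.
  by move=> x; exact: derivableM.
rewrite (_ : derive1 _ = (fun x => f x * derive1 g x + g x * derive1 f x)); last first.
  by apply/funext => x; rewrite !derive1E deriveM.
by apply: smoothnD; apply: IH => //; exact: smoothn_leS.
Qed.

Lemma smoothn_cst n (c : R) : smoothn n (fun=> c).
Proof.
elim: n c => [|n IH] c; first by move=> [|//] x _; exact: derivable_cst.
apply/smoothnS; split; first by move=> x; exact: derivable_cst.
rewrite (_ : derive1 _ = (fun=> 0)); first exact: IH.
by apply/funext => x; rewrite derive1_cst.
Qed.

Lemma smooth_smoothn (f : R -> R) : smooth f <-> forall n, smoothn n f.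
Proof. by split=> [H n k x _|H n x]; [exact: H|exact: (H n n)]. Qed.

Lemma smooth_sqr (f : R -> R) : smooth f -> smooth (fun x => f x ^+ 2).
Proof.
move=> /smooth_smoothn H; apply/smooth_smoothn => n.
by under [X in smoothn n X]eq_fun do rewrite expr2; exact: smoothnM.
Qed.

Lemma smooth_onem (f : R -> R) : smooth f -> smooth (fun x => 1 - f x).
Proof.
move=> /smooth_smoothn H; apply/smooth_smoothn => n.
under [X in smoothn n X]eq_fun do rewrite -mulN1r.
by apply: smoothnD; [exact: smoothn_cst|apply: smoothnM => //; exact: smoothn_cst].
Qed.

End smooth_algebra.

(** * Continuity of the pairing for the weighted norm *)

Section weighted_pairing.
Context {R : realType}.
Notation mu := (@lebesgue_measure R).
Local Notation mfun f := (measurable_fun (setT : set R) (f : R -> R)).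

Lemma normW_ae s (f g : R -> R) : mfun f -> mfun g ->
  {ae mu, forall x, f x = g x} -> normW s f = normW s g.
Proof.
move=> mf mg fg; apply: ge0_ae_eq_integral => //.
- by apply/measurable_EFinP; exact: measurable_wsqr.
- by apply/measurable_EFinP; exact: measurable_wsqr.
- by move=> x _; rewrite lee_fin wsqr_ge0.
- by move=> x _; rewrite lee_fin wsqr_ge0.
- by apply: ae_impl fg => x -> _.
Qed.

Lemma normW_fin s (f : R -> R) : (normW s f < +oo)%E -> exists2 a, 0 <= a & (normW s f <= a%:E)%E.
Proof.
move=> ff; exists (fine (normW s f)); first by rewrite fine_ge0// normW_ge0.
by rewrite fineK// ge0_fin_numE// normW_ge0.
Qed.

(** The complement of the finite exceptional set is open and [m] is continuous there; on the
    exceptional set every preimage is finite. *)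
Lemma measurable_piecewise_continuous (m : R -> R) : piecewise_continuous m -> mfun m.
Proof.
move=> [D [cD _]].
have fD : finite_set [set` D] by exact: finite_seq.
have oD : open (~` [set` D] : set R).
  have /accessible_finite_set_closed H := hausdorff_accessible (@Rhausdorff R).
  by rewrite openC; exact: H.
rewrite -(setUv [set` D]); apply/measurable_funU.
- by apply: countable_measurable => //; exact: finite_set_countable.
- exact: open_measurable.
split.
  move=> _ B mB; apply: countable_measurable => //; apply: finite_set_countable.
  by apply: sub_finite_set fD => x [].
apply: open_continuous_measurable_fun => // x; rewrite inE/= => /negP xD.
exact: cD.
Qed.

(** The constant is [A2]: for [|x| >= 1], [|x|^s = (x^2)^(s/2)] is below the weight, and for
    [|x| <= 1] the weight is at least [1]. *)
Lemma symbol_bound s (m : R -> R) : assumptionA s m ->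
  exists2 K, 0 < K & forall x, `|m x| <= K * wt s x.
Proof.
move=> [s0 [_ [A1 [A2 [A10 [A20 [H1 H2]]]]]]]; exists A2 => // x.
have [x1|x1] := leP 1 `|x|.
  have [l1 l2] := H1 x x1.
  rewrite ger0_norm; last by apply: le_trans l1; rewrite mulr_ge0 ?powR_ge0// ltW.
  apply: (le_trans l2); rewrite ler_wpM2l ?(ltW A20)//.
  have -> : `|x| `^ s = (x ^+ 2) `^ (s / 2).
    by rewrite -(real_normK (num_real x)) -powR_mulrn// -powRrM; congr (_ `^ _); field.
  apply: ge0_ler_powR; rewrite ?nnegrE ?sqr_ge0 ?divr_ge0 ?(ltW s0) ?(ltW (onePsqr_gt0 _))//.
  by rewrite lerDr.
have [l1 l2] := H2 x (ltW x1).
by rewrite ger0_norm// (le_trans l2)// ler_peMr ?(ltW A20)// wt_ge1// ltW.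
Qed.

(** Young's inequality with a free parameter in place of Cauchy-Schwarz: a large [l] makes the
    contribution of a merely bounded factor [b] small, provided the norm of [a] is smaller still. *)
Lemma pairing_bound s (m a b : R -> R) (K al be l : R) : mfun m -> mfun a -> mfun b ->
  0 < K -> (forall x, `|m x| <= K * wt s x) -> 0 < l ->
  (normW s a <= al%:E)%E -> (normW s b <= be%:E)%E ->
  mu.-integrable setT (EFin \o (fun x => m x * (a x * b x))) /\
  `|\int[mu]_x (m x * (a x * b x))| <= K * (l * al + l^-1 * be).
Proof.
move=> mm ma mb K0 mK l0 Na Nb.
have mi : mfun (fun x => m x * (a x * b x)).
  by apply: measurable_funM => //; exact: measurable_funM.
have mA := measurable_wsqr s a ma; have mB := measurable_wsqr s b mb.
have A0 := wsqr_ge0 s a; have B0 := wsqr_ge0 s b.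
have lV0 : 0 < l^-1 by rewrite invr_gt0.
have mlA : mfun (fun x => l * (wt s x * a x ^+ 2)) by exact: measurable_funM.
have mlB : mfun (fun x => l^-1 * (wt s x * b x ^+ 2)) by exact: measurable_funM.
have lA0 x : 0 <= l * (wt s x * a x ^+ 2) by rewrite mulr_ge0// ltW.
have lB0 x : 0 <= l^-1 * (wt s x * b x ^+ 2) by rewrite mulr_ge0// ltW.
have le : (intR (fun x => `|m x * (a x * b x)|)%R <= (K * (l * al + l^-1 * be))%:E)%E.
  apply: (@le_trans _ _ (intR (fun x => K * (l * (wt s x * a x ^+ 2) + l^-1 * (wt s x * b x ^+ 2))))).
    apply: le_intR.
    - exact: measurableT_comp.
    - by apply: measurable_funM => //; exact: measurable_funD.
    - by [].
    move=> x; rewrite normrM normrM.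
    apply: (le_trans (ler_wpM2r _ (mK x))); first by rewrite mulr_ge0.
    rewrite -mulrA ler_wpM2l ?(ltW K0)//.
    rewrite [l * _]mulrCA [l^-1 * _]mulrCA -mulrDr ler_wpM2l ?wt_ge0//.
    rewrite -(real_normK (num_real (a x))) -(real_normK (num_real (b x))).
    (* [2 |a| |b| <= l a^2 + b^2 / l] *)
    have -> : l^-1 * `|b x| ^+ 2 = l * (l^-1 * `|b x|) ^+ 2.
      by field; exact: lt0r_neq0.
    have {1}-> : `|b x| = l * (l^-1 * `|b x|) by rewrite mulrA divff ?mul1r// lt0r_neq0.
    move: (l^-1 * `|b x|) (mulr_ge0 (ltW lV0) (normr_ge0 (b x))) => c c0.
    rewrite mulrCA -mulrDr ler_wpM2l ?(ltW l0)//.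
    have := sqr_ge0 (`|a x| - c); have := mulr_ge0 (normr_ge0 (a x)) c0; nra.
  rewrite intRZ ?(ltW K0)//; last 2 first.
  - exact: measurable_funD.
  - by move=> x; rewrite addr_ge0.
  rewrite intRD// intRZ ?(ltW l0)// intRZ ?(ltW lV0)//.
  rewrite (EFinM K) lee_wpmul2l ?lee_fin ?(ltW K0)//.
  rewrite (EFinD (l * al)) (EFinM l) (EFinM l^-1); apply: leeD.
    by apply: lee_wpmul2l; [rewrite lee_fin ltW|exact: Na].
  by apply: lee_wpmul2l; [rewrite lee_fin ltW|exact: Nb].
have i : mu.-integrable setT (EFin \o (fun x => m x * (a x * b x))).
  apply/integrableP; split; first exact/measurable_EFinP.
  exact: (le_lt_trans le (ltry _)).
split => //; rewrite -lee_fin; apply: le_trans le.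
rewrite EFin_normr_Rintegral//; apply: le_abse_integral => //.
exact/measurable_EFinP.
Qed.

(** With [df] and [dg] the differences to the limits, [f_ g_ - f g = df dg + df g + dg f].
    Integrability is claimed only for large [n], since the norms of the differences are known to be
    finite only then. *)
Lemma pairing_cvg_real s (m : R -> R) (f_ g_ : nat -> R -> R) (f g : R -> R) (K : R) :
  mfun m -> 0 < K -> (forall x, `|m x| <= K * wt s x) ->
  (forall n, mfun (f_ n)) -> (forall n, mfun (g_ n)) -> mfun f -> mfun g ->
  (normW s f < +oo)%E -> (normW s g < +oo)%E ->
  normW s (fun x => f_ n x - f x) @[n --> \oo] --> 0%E ->
  normW s (fun x => g_ n x - g x) @[n --> \oo] --> 0%E ->
  [/\ mu.-integrable setT (EFin \o (fun x => m x * (f x * g x))),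
      \forall n \near \oo, mu.-integrable setT (EFin \o (fun x => m x * (f_ n x * g_ n x))) &
      \int[mu]_x (m x * (f_ n x * g_ n x)) @[n --> \oo] --> \int[mu]_x (m x * (f x * g x))].
Proof.
move=> mm K0 mK mf_ mg_ mf mg ff gf fc gc.
have [al al0 Nf] := normW_fin _ _ ff; have [be be0 Ng] := normW_fin _ _ gf.
have mdf n : mfun (fun x => f_ n x - f x) by exact: measurable_funB.
have mdg n : mfun (fun x => g_ n x - g x) by exact: measurable_funB.
have [i0 _] := pairing_bound s m f g K al be 1 mm mf mg K0 mK ltr01 Nf Ng.
have Hf := (cvge0P _ (fun n => normW_ge0 s _)).1 fc.
have Hg := (cvge0P _ (fun n => normW_ge0 s _)).1 gc.
have key l d n : 0 < l -> (normW s (fun x => f_ n x - f x)%R <= d%:E)%E ->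
    (normW s (fun x => g_ n x - g x)%R <= d%:E)%E ->
    mu.-integrable setT (EFin \o (fun x => m x * (f_ n x * g_ n x))) /\
    `|\int[mu]_x (m x * (f_ n x * g_ n x)) - \int[mu]_x (m x * (f x * g x))| <=
    K * (2 * d + 2 * l * d + l^-1 * (al + be)).
  move=> l0 nf ng.
  have [i1 b1] := pairing_bound s m _ _ K d d 1 mm (mdf n) (mdg n) K0 mK ltr01 nf ng.
  have [i2 b2] := pairing_bound s m _ _ K d be l mm (mdf n) mg K0 mK l0 nf Ng.
  have [i3 b3] := pairing_bound s m _ _ K d al l mm (mdg n) mf K0 mK l0 ng Nf.
  have i12 := integrableD measurableT i1 i2.
  have i123 := integrableD measurableT i12 i3.
  have i0123 := integrableD measurableT i123 i0.
  have ifg : mu.-integrable setT (EFin \o (fun x => m x * (f_ n x * g_ n x))).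
    move: i0123; congr (mu.-integrable _ _); apply/funext => x /=.
    by congr EFin; ring.
  split => //.
  have E : \int[mu]_x (m x * (f_ n x * g_ n x)) - \int[mu]_x (m x * (f x * g x)) =
      \int[mu]_x (m x * ((f_ n x - f x) * (g_ n x - g x))) +
      \int[mu]_x (m x * ((f_ n x - f x) * g x)) +
      \int[mu]_x (m x * ((g_ n x - g x) * f x)).
    have e12 := RintegralD measurableT i1 i2.
    have e123 := RintegralD measurableT i12 i3.
    rewrite -(RintegralB measurableT ifg i0) -e12 -e123.
    by apply: eq_Rintegral => x _; ring.
  rewrite E; apply: (le_trans (ler_normD _ _)).
  apply: (le_trans (lerD (ler_normD _ _) (lexx _))).
  apply: (le_trans (lerD (lerD b1 b2) b3)).
  by rewrite invr1 le_eqVlt; apply/orP; left; apply/eqP; ring.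
split => //.
  near=> n.
  have nf : (normW s (fun x => f_ n x - f x)%R <= 1%:E)%E by near: n; exact: Hf.
  have ng : (normW s (fun x => g_ n x - g x)%R <= 1%:E)%E by near: n; exact: Hg.
  by have [] := key 1 1 n ltr01 nf ng.
apply/cvgrPdist_le => e e0.
(* [l] is fixed first, so that [K (al + be) / l <= e / 2]; then [d] is chosen in terms of [l], so
   that the remaining terms [2 K (1 + l) d] equal [e / 2]. *)
pose l := 2 * K * (al + be) / e + 1.
have l0 : 0 < l.
  by rewrite ltr_wpDl// divr_ge0 ?(ltW e0)// !mulr_ge0 ?addr_ge0// ltW.
pose d := e / (4 * K * (1 + l)).
have d0 : 0 < d by rewrite divr_gt0// !mulr_gt0// addr_gt0.
near=> n.
have nf : (normW s (fun x => f_ n x - f x)%R <= d%:E)%E by near: n; exact: Hf.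
have ng : (normW s (fun x => g_ n x - g x)%R <= d%:E)%E by near: n; exact: Hg.
have [_] := key l d n l0 nf ng; rewrite distrC => /le_trans; apply.
have -> : K * (2 * d + 2 * l * d + l^-1 * (al + be)) =
    2 * K * (1 + l) * d + K * (al + be) / l by ring.
have -> : 2 * K * (1 + l) * d = e / 2.
  by rewrite /d; field; rewrite !lt0r_neq0// addr_gt0.
suff : K * (al + be) / l <= e / 2 by lra.
rewrite ler_pdivrMr//.
have -> : e / 2 * l = K * (al + be) + e / 2 by rewrite /l; field; exact: lt0r_neq0.
by rewrite lerDl divr_ge0// ltW.
Unshelve. all: by end_near. Qed.

End weighted_pairing.

(** * Convergence of the transforms of truncated functions *)

Section cutoffs.
Context {R : realType}.
Notation mu := (@lebesgue_measure R).
Local Notation mfun f := (measurable_fun (setT : set R) (f : R -> R)).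

(** [in_H] provides a transform [U'] of finite weighted norm; it has the same integrals over
    intervals as the given [U], hence equals it almost everywhere. *)
Lemma in_H_normW s (u U : R -> R * R) : 0 < s -> in_H s u -> is_FT u U ->
  (normW s (fun x => (U x).1) < +oo)%E /\ (normW s (fun x => (U x).2) < +oo)%E.
Proof.
move=> s0 [u2 [U' [FT' i']]] FT.
have [L2U FTU] := FT; have [L2U' FTU'] := FT'.
have [m1 m2 i1 i2] := L2_components U L2U.
have [m1' m2' i1' i2'] := L2_components U' L2U'.
have e1 : {ae mu, forall x, (U x).1 = (U' x).1}.
  apply: eq_itv_integral_ae => // [a b|a b|a b ab]; do ?exact: sqr_integrable_itv.
  by have := congr1 fst (FTU a b ab); rewrite -FTU'//= => ->.
have e2 : {ae mu, forall x, (U x).2 = (U' x).2}.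
  apply: eq_itv_integral_ae => // [a b|a b|a b ab]; do ?exact: sqr_integrable_itv.
  by have := congr1 snd (FTU a b ab); rewrite -FTU'//= => ->.
rewrite (normW_ae s _ _ m1 m1' e1) (normW_ae s _ _ m2 m2' e2).
have mi : mfun (fun x => wt s x * cnorm2 (U' x)).
  apply: measurable_funM; first exact: measurable_wt.
  by apply: measurable_funD; exact: measurable_funX.
have n0 x : 0 <= cnorm2 (U' x) by rewrite addr_ge0 ?sqr_ge0.
have ii : (intR (fun x => wt s x * cnorm2 (U' x))%R < +oo)%E.
  move/integrableP : i' => [_]; apply: le_lt_trans.
  apply: le_intR => //; first exact: measurableT_comp.
  - by move=> x; rewrite mulr_ge0 ?wt_ge0.
  - by move=> x; rewrite ler_norm.
split; apply: le_lt_trans ii; apply: le_intR => //; do ?exact: measurable_wsqr;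
  do ?[by move=> x; rewrite mulr_ge0 ?wt_ge0 ?sqr_ge0];
  move=> x; rewrite ler_wpM2l ?wt_ge0//.
- by rewrite lerDl sqr_ge0.
- by rewrite lerDr sqr_ge0.
Qed.

Lemma Rintegral_ftrig_cos (chi : R -> R) : bump chi -> (forall x, 0 <= chi x <= 1) ->
  \int[mu]_y ftrig cos chi y = chi 0.
Proof.
move=> bc c01; rewrite -(fourier_inversion 0 chi bc c01); apply: eq_Rintegral => y _.
by rewrite mulr0 mul0r cos0 sin0 mulr1 mulr0 addr0.
Qed.

Lemma Rintegral_ftrig_sin (chi : R -> R) : bump chi -> \int[mu]_y ftrig sin chi y = 0.
Proof.
move=> bc; apply: Rintegral_odd => [|y]; last exact: ftrig_sinN.
by have /measurable_EFinP := measurable_int _ (integrable_ftrig sin chi (or_intror erefl) bc).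
Qed.

(** Each component of [V n] is a combination of two averages. The factors [1] and [0] below are the
    masses of their kernels: [chi 0], by inversion at the origin, and the integral of an odd
    function. *)
Lemma cvg_FT_cutoff s (u U : R -> R * R) (chi : R -> R) (V : nat -> R -> R * R) (t : nat -> R) :
  0 < s -> in_H s u -> is_FT u U ->
  bump chi -> (forall x, 0 <= chi x <= 1) -> chi 0 = 1 ->
  t n @[n --> \oo] --> (0 : R) ->
  (\forall n \near \oo, is_FT (rmulf (fun x => chi (x * t n)) u) (V n)) ->
  normW s (fun x => (V n x).1 - (U x).1) @[n --> \oo] --> 0%E /\
  normW s (fun x => (V n x).2 - (U x).2) @[n --> \oo] --> 0%E.
Proof.
move=> s0 uH FT bc c01 chi0 t0 FTV.
have [u2 _] := uH; have [L2U _] := FT.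
have [f1 f2] := in_H_normW s u U s0 uH FT.
have [m1 m2 _ _] := L2_components U L2U.
have ikc := integrable_ftrig cos chi (or_introl erefl) bc.
have iks := integrable_ftrig sin chi (or_intror erefl) bc.
have wkc := intR_wt_ftrig s cos chi (or_introl erefl) bc.
have wks := intR_wt_ftrig s sin chi (or_intror erefl) bc.
have mkc : mfun (ftrig cos chi) by have /measurable_EFinP := measurable_int _ ikc.
have mks : mfun (ftrig sin chi) by have /measurable_EFinP := measurable_int _ iks.
have cv k f := cvg_conv s k f t (ltW s0).
have P0 (F : nat -> R -> R) : forall n, (0 <= normW s (F n))%E by move=> n; exact: normW_ge0.
have c1 := (cvge0P _ (P0 _)).1 (cv _ _ ikc wkc m1 f1 t0).
have c2 := (cvge0P _ (P0 _)).1 (cv _ _ ikc wkc m2 f2 t0).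
have s1 := (cvge0P _ (P0 _)).1 (cv _ _ iks wks m1 f1 t0).
have s2 := (cvge0P _ (P0 _)).1 (cv _ _ iks wks m2 f2 t0).
rewrite (Rintegral_ftrig_cos chi bc c01) chi0 in c1 c2.
rewrite (Rintegral_ftrig_sin chi bc) in s1 s2.
have mcv k f tt : mfun k -> mfun f -> forall c, mfun (fun x => conv k f tt x - c * f x).
  by move=> mk mf c; apply: measurable_funB; [exact: measurable_conv|exact: measurable_funM].
split; apply/cvge0P => [n|e e0]; do ?exact: normW_ge0;
  have e4 : 0 < e / 4 by [rewrite divr_gt0].
- near=> n.
  have n1 : (normW s (fun x => conv (ftrig cos chi) (fun x => (U x).1) (t n) x - 1 * (U x).1)%R
    <= (e / 4)%:E)%E by near: n; exact: c1.
  have n2 : (normW s (fun x => - (conv (ftrig sin chi) (fun x => (U x).2) (t n) x - 0 * (U x).2))%R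
    <= (e / 4)%:E)%E by rewrite normWN; near: n; exact: s2.
  have FTn : is_FT (rmulf (fun x => chi (x * t n)) u) (V n) by near: n; exact: FTV.
  have [L2V _] := FTn; have [mV1 mV2 _ _] := L2_components _ L2V.
  have [E _] := is_FT_mul_conv u U (V n) chi (t n) u2 FT bc c01 FTn.
  have mA := mcv _ _ (t n) mkc m1 1.
  have mB : mfun (fun x => - (conv (ftrig sin chi) (fun x => (U x).2) (t n) x - 0 * (U x).2)).
    by apply: measurableT_comp => //; exact: mcv.
  have := le_normWD_fin s _ _ _ _ mA mB n1 n2.
  rewrite (_ : 2 * (e / 4) + 2 * (e / 4) = e); last by field.
  apply: le_trans; rewrite le_eqVlt; apply/orP; left; apply/eqP; apply: normW_ae.
  + exact: measurable_funB.
  + exact: measurable_funD.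
  + by apply: ae_impl E => x ->; ring.
- near=> n.
  have n1 : (normW s (fun x => conv (ftrig cos chi) (fun x => (U x).2) (t n) x - 1 * (U x).2)%R
    <= (e / 4)%:E)%E by near: n; exact: c2.
  have n2 : (normW s (fun x => conv (ftrig sin chi) (fun x => (U x).1) (t n) x - 0 * (U x).1)%R
    <= (e / 4)%:E)%E by near: n; exact: s1.
  have FTn : is_FT (rmulf (fun x => chi (x * t n)) u) (V n) by near: n; exact: FTV.
  have [L2V _] := FTn; have [mV1 mV2 _ _] := L2_components _ L2V.
  have [_ E] := is_FT_mul_conv u U (V n) chi (t n) u2 FT bc c01 FTn.
  have mA := mcv _ _ (t n) mkc m2 1.
  have mB := mcv _ _ (t n) mks m1 0.
  have := le_normWD_fin s _ _ _ _ mA mB n1 n2.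
  rewrite (_ : 2 * (e / 4) + 2 * (e / 4) = e); last by field.
  apply: le_trans; rewrite le_eqVlt; apply/orP; left; apply/eqP; apply: normW_ae.
  + exact: measurable_funB.
  + exact: measurable_funD.
  + by apply: ae_impl E => x ->; ring.
Unshelve. all: by end_near. Qed.

Lemma L2_sub (f g : R -> R * R) : L2 f -> L2 g -> L2 (fun x => csub (f x) (g x)).
Proof.
move=> Lf Lg; have [f1 f2 i1 i2] := L2_components f Lf; have [g1 g2 j1 j2] := L2_components g Lg.
have m1 : mfun (fun x => (f x).1 - (g x).1) by exact: measurable_funB.
have m2 : mfun (fun x => (f x).2 - (g x).2) by exact: measurable_funB.
have b (p q : R -> R) : mfun p -> mfun q -> (intR (fun x => p x ^+ 2)%R < +oo)%E ->
    (intR (fun x => q x ^+ 2)%R < +oo)%E ->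
    mu.-integrable setT (EFin \o (fun x => (p x - q x) ^+ 2)).
  move=> mp mq ip iq.
  have mp2 : mfun (fun x => p x ^+ 2) by exact: measurable_funX.
  have mq2 : mfun (fun x => q x ^+ 2) by exact: measurable_funX.
  apply: integrable_intR.
  - by apply: measurable_funX; exact: measurable_funB.
  - by move=> x; exact: sqr_ge0.
  apply: (@le_lt_trans _ _ (intR (fun x => 2 * (p x ^+ 2) + 2 * (q x ^+ 2)))).
    apply: le_intR.
    - by apply: measurable_funX; exact: measurable_funB.
    - by apply: measurable_funD; exact: measurable_funM.
    - by move=> x; exact: sqr_ge0.
    - by move=> x; have := sqr_ge0 (p x + q x); nra.
  rewrite intRD; do ?[exact: measurable_funM|by move=> x; rewrite mulr_ge0 ?sqr_ge0].
  rewrite !intRZ//; do ?[by move=> x; rewrite sqr_ge0].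
  by apply: lte_add_pinfty; rewrite lte_mul_pinfty.
split => //; split => //.
have := integrableD measurableT (b _ _ f1 g1 i1 j1) (b _ _ f2 g2 i2 j2).
by congr (mu.-integrable _ _); apply/funext.
Qed.

Lemma L2_bounded_mul (c : R -> R) (u : R -> R * R) : mfun c -> (forall x, 0 <= c x <= 1) ->
  L2 u -> L2 (rmulf c u).
Proof.
move=> mc c01 [m1 [m2 i]].
have M1 : mfun (fun x => c x * (u x).1) by exact: measurable_funM.
have M2 : mfun (fun x => c x * (u x).2) by exact: measurable_funM.
split => //; split => //.
apply: le_integrable i => //.
  by apply/measurable_EFinP; apply: measurable_funD; exact: measurable_funX.
move=> x _ /=; rewrite lee_fin /cnorm2 /rmulf /cscale/= !exprMn -mulrDr.
have [c0 c1] := andP (c01 x).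
rewrite !ger0_norm ?mulr_ge0 ?addr_ge0 ?sqr_ge0//.
by rewrite ler_piMl ?addr_ge0 ?sqr_ge0// exprn_ile1.
Qed.

Lemma is_FT_onem (u U V : R -> R * R) (c : R -> R) : mfun c -> (forall x, 0 <= c x <= 1) ->
  L2 u -> is_FT u U -> is_FT (rmulf c u) V ->
  is_FT (rmulf (fun x => 1 - c x) u) (fun x => csub (U x) (V x)).
Proof.
move=> mc c01 Lu [LU FU] [LV FV]; split; first exact: L2_sub.
move=> a b ab.
have [U1 U2 iU1 iU2] := L2_components _ LU; have [V1 V2 iV1 iV2] := L2_components _ LV.
have [j1 j2] := integrable_cmul_kern u a b Lu.
have [k1 k2] := integrable_cmul_kern _ a b (L2_bounded_mul c u mc c01 Lu).
have aU1 := sqr_integrable_itv _ a b U1 iU1; have aU2 := sqr_integrable_itv _ a b U2 iU2.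
have aV1 := sqr_integrable_itv _ a b V1 iV1; have aV2 := sqr_integrable_itv _ a b V2 iV2.
have := FU a b ab; have := FV a b ab; rewrite /cint => -[v1 v2] [u1 u2].
congr pair.
- transitivity (\int[mu]_(x in `[a, b]) (U x).1 - \int[mu]_(x in `[a, b]) (V x).1).
    by rewrite -(RintegralB _ aU1 aV1).
  rewrite u1 v1 -(RintegralB measurableT j1 k1); apply: eq_Rintegral => x _.
  by rewrite /rmulf /=; move: (kern a b x) (u x) => [? ?] [? ?] /=; ring.
- transitivity (\int[mu]_(x in `[a, b]) (U x).2 - \int[mu]_(x in `[a, b]) (V x).2).
    by rewrite -(RintegralB _ aU2 aV2).
  rewrite u2 v2 -(RintegralB measurableT j2 k2); apply: eq_Rintegral => x _.
  by rewrite /rmulf /=; move: (kern a b x) (u x) => [? ?] [? ?] /=; ring.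
Qed.

(** The complex pairing splits into four real ones. Splitting an integral requires integrability of
    the pieces, which holds for large [n], so the splitting is used along the limit only. *)
Lemma pairing_cvg s (m : R -> R) (V W : nat -> R -> R * R) (v w : R -> R * R) :
  assumptionA s m ->
  (forall n, L2 (V n)) -> (forall n, L2 (W n)) ->
  mfun (fun x => (v x).1) -> mfun (fun x => (v x).2) ->
  mfun (fun x => (w x).1) -> mfun (fun x => (w x).2) ->
  (normW s (fun x => (v x).1) < +oo)%E -> (normW s (fun x => (v x).2) < +oo)%E ->
  (normW s (fun x => (w x).1) < +oo)%E -> (normW s (fun x => (w x).2) < +oo)%E ->
  normW s (fun x => (V n x).1 - (v x).1) @[n --> \oo] --> 0%E ->
  normW s (fun x => (V n x).2 - (v x).2) @[n --> \oo] --> 0%E ->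
  normW s (fun x => (W n x).1 - (w x).1) @[n --> \oo] --> 0%E ->
  normW s (fun x => (W n x).2 - (w x).2) @[n --> \oo] --> 0%E ->
  (pairing m (V n) (W n)).1 @[n --> \oo] --> (pairing m v w).1 /\
  (pairing m (V n) (W n)).2 @[n --> \oo] --> (pairing m v w).2.
Proof.
move=> hA LV LW mv1 mv2 mw1 mw2 v1 v2 w1 w2 V1 V2 W1 W2.
have [K K0 mK] := symbol_bound s m hA.
have mm : mfun m by apply: measurable_piecewise_continuous; case: hA => _ [].
have mV1 n : mfun (fun x => (V n x).1) by have [] := L2_components _ (LV n).
have mV2 n : mfun (fun x => (V n x).2) by have [] := L2_components _ (LV n).
have mW1 n : mfun (fun x => (W n x).1) by have [] := L2_components _ (LW n).
have mW2 n : mfun (fun x => (W n x).2) by have [] := L2_components _ (LW n).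
have [i11 I11 c11] := pairing_cvg_real s m _ _ _ _ K mm K0 mK mV1 mW1 mv1 mw1 v1 w1 V1 W1.
have [i22 I22 c22] := pairing_cvg_real s m _ _ _ _ K mm K0 mK mV2 mW2 mv2 mw2 v2 w2 V2 W2.
have [i12 I12 c12] := pairing_cvg_real s m _ _ _ _ K mm K0 mK mV1 mW2 mv1 mw2 v1 w2 V1 W2.
have [i21 I21 c21] := pairing_cvg_real s m _ _ _ _ K mm K0 mK mV2 mW1 mv2 mw1 v2 w1 V2 W1.
have p1 (f g : R -> R * R) :
    mu.-integrable setT (EFin \o (fun x => m x * ((f x).1 * (g x).1))) ->
    mu.-integrable setT (EFin \o (fun x => m x * ((f x).2 * (g x).2))) ->
    (pairing m f g).1 = \int[mu]_x (m x * ((f x).1 * (g x).1)) +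
                        \int[mu]_x (m x * ((f x).2 * (g x).2)).
  move=> a1 a2; rewrite -(RintegralD measurableT a1 a2); apply: eq_Rintegral => x _.
  by move: (f x) (g x) => [? ?] [? ?] /=; ring.
have p2 (f g : R -> R * R) :
    mu.-integrable setT (EFin \o (fun x => m x * ((f x).1 * (g x).2))) ->
    mu.-integrable setT (EFin \o (fun x => m x * ((f x).2 * (g x).1))) ->
    (pairing m f g).2 = \int[mu]_x (m x * ((f x).1 * (g x).2)) -
                        \int[mu]_x (m x * ((f x).2 * (g x).1)).
  move=> a1 a2; rewrite -(RintegralB measurableT a1 a2); apply: eq_Rintegral => x _.
  by move: (f x) (g x) => [? ?] [? ?] /=; ring.
split.
  rewrite (p1 _ _ i11 i22); apply: cvg_trans (cvgD c11 c22).
  apply: near_eq_cvg; near=> n; rewrite p1//; [near: n; exact: I11|near: n; exact: I22].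
rewrite (p2 _ _ i12 i21); apply: cvg_trans (cvgB c12 c21).
apply: near_eq_cvg; near=> n; rewrite p2//; [near: n; exact: I12|near: n; exact: I21].
Unshelve. all: by end_near. Qed.

End cutoffs.

(** * The limit of the commutator terms *)

Section commutator_limit.
Context {R : realType}.
Notation mu := (@lebesgue_measure R).
Local Notation mfun f := (measurable_fun (setT : set R) (f : R -> R)).

(** Replacing [r n] by [max 1 (r n)] changes only finitely many terms. Sequences are needed for
    dominated convergence, and positive ones because the transforms are given for [r > 0]. *)
Lemma cvg_pinfty_pos (f : R -> R) (l : R) :
  (forall r : nat -> R, (forall n, 0 < r n) -> r n @[n --> \oo] --> +oo ->
     f (r n) @[n --> \oo] --> l) -> f x @[x --> +oo] --> l.
Proof.
move=> H; apply/cvg_pinftyP => r roo.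
have E : \forall n \near \oo, Num.max 1 (r n) = r n.
  near=> n; apply/max_idPr; near: n.
  by move/cvgryPge : roo; exact.
have roo' : Num.max 1 (r n) @[n --> \oo] --> +oo.
  by apply: cvg_trans roo; apply: near_eq_cvg; apply: filterS E => n ->.
have r0 n : 0 < Num.max 1 (r n) by rewrite lt_max ltr01.
have := H (fun n => Num.max 1 (r n)) r0 roo'.
apply: cvg_trans; apply: near_eq_cvg; apply: filterS E => n /= ->.
Unshelve. all: by end_near. Qed.

Lemma cvg_inv_pinfty (r : nat -> R) : (forall n, 0 < r n) ->
  r n @[n --> \oo] --> +oo -> (r n)^-1 @[n --> \oo] --> (0 : R).
Proof. by move=> r0 roo; apply/gtr0_cvgV0 => //; exact: nearW. Qed.

Definition approaches s (F : R -> R -> R * R) (v : R -> R * R) :=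
  forall r : nat -> R, (forall n, 0 < r n) -> r n @[n --> \oo] --> +oo ->
  normW s (fun x => (F (r n) x).1 - (v x).1) @[n --> \oo] --> 0%E /\
  normW s (fun x => (F (r n) x).2 - (v x).2) @[n --> \oo] --> 0%E.

(** The two pairings tend to [pairing m v v] and [pairing m v U], whence the condition that these
    agree. It is trivial for [v = U], the case of [phi], and both sides are [0] for [v = 0], the
    case of [psi]. *)
Lemma commutator_cvg s (m : R -> R) (U v : R -> R * R) (F G : R -> R -> R * R) :
  assumptionA s m -> L2 U ->
  (normW s (fun x => (U x).1) < +oo)%E -> (normW s (fun x => (U x).2) < +oo)%E ->
  L2 v -> (normW s (fun x => (v x).1) < +oo)%E -> (normW s (fun x => (v x).2) < +oo)%E ->
  (forall r, 0 < r -> L2 (F r)) -> (forall r, 0 < r -> L2 (G r)) ->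
  approaches s F v -> approaches s G v -> pairing m v v = pairing m v U ->
  let Q := fun r => csub (pairing m (F r) (F r)) (pairing m (G r) U) in
  ((Q r).1 @[r --> +oo] --> (0 : R)) /\ ((Q r).2 @[r --> +oo] --> (0 : R)).
Proof.
move=> hA LU U1 U2 Lv v1 v2 LF LG Fv Gv E Q.
have [mU1 mU2 _ _] := L2_components U LU; have [mv1 mv2 _ _] := L2_components v Lv.
have UU (p : R * R -> R) : normW s (fun x => p (U x) - p (U x)) @[n --> \oo] --> 0%E.
  rewrite (eq_normW s _ (fun=> 0)) => [|x]; last by rewrite subrr.
  rewrite /normW (eq_intR _ (fun=> 0)) => [|x]; last by rewrite expr0n/= mulr0.
  by rewrite /intR integral0; exact: cvg_cst.
have H r : (forall n, 0 < r n) -> r n @[n --> \oo] --> +oo ->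
    (Q (r n)).1 @[n --> \oo] --> (0 : R) /\ (Q (r n)).2 @[n --> \oo] --> (0 : R).
  move=> r0 roo; have [F1 F2] := Fv r r0 roo; have [G1 G2] := Gv r r0 roo.
  have LFr n := LF _ (r0 n); have LGr n := LG _ (r0 n).
  have [a1 a2] := pairing_cvg s m _ _ v v hA LFr LFr mv1 mv2 mv1 mv2 v1 v2 v1 v2 F1 F2 F1 F2.
  have [b1 b2] := pairing_cvg s m _ (fun=> U) v U hA LGr (fun=> LU) mv1 mv2 mU1 mU2
    v1 v2 U1 U2 G1 G2 (UU fst) (UU snd).
  have c1 := cvgB a1 b1; have c2 := cvgB a2 b2; rewrite E subrr in c1; rewrite E subrr in c2.
  by split; [exact: c1|exact: c2].
by split; apply: cvg_pinfty_pos => r r0 roo; have [] := H r r0 roo.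
Qed.

Lemma cutoff_approaches s (u U : R -> R * R) (chi : R -> R) (F : R -> R -> R * R) :
  0 < s -> in_H s u -> is_FT u U -> smooth chi ->
  (forall x, 2 < `|x| -> chi x = 0) -> (forall x, 0 <= chi x <= 1) -> chi 0 = 1 ->
  (forall r, 0 < r -> is_FT (rmulf (fun x => chi (x / r)) u) (F r)) ->
  approaches s F U.
Proof.
move=> s0 uH FT sc c0 c01 chi0 FF r r0 roo.
apply: (cvg_FT_cutoff s u U chi (fun n => F (r n)) (fun n => (r n)^-1)) => //.
- exact: cvg_inv_pinfty.
- by apply: nearW => n; exact: FF.
Qed.

(** [1 - chi] is a cut-off with value [1] at [0], and by linearity the corresponding transform is
    [U - F]. This tends to [U], so [F] tends to [0]. *)
Lemma cocutoff_approaches s (u U : R -> R * R) (chi : R -> R) (F : R -> R -> R * R) :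
  0 < s -> in_H s u -> is_FT u U -> smooth chi ->
  (forall x, 2 < `|x| -> chi x = 1) -> (forall x, 0 <= chi x <= 1) -> chi 0 = 0 ->
  (forall r, 0 < r -> is_FT (rmulf (fun x => chi (x / r)) u) (F r)) ->
  approaches s F (fun=> (0, 0)).
Proof.
move=> s0 uH FT sc c0 c01 chi0 FF r r0 roo.
have [u2 _] := uH.
have mchi (t : R) : mfun (fun x => chi (x * t)).
  apply: (@measurableT_comp _ _ _ _ _ _ chi).
    by apply: continuous_measurable_fun; exact: (smooth_continuous _ 0%N).
  exact: measurable_funM.
have FU q : 0 < q -> is_FT (rmulf (fun x => 1 - chi (x / q)) u) (fun x => csub (U x) (F q x)).
  by move=> q0; apply: is_FT_onem => //; exact: FF.
have := cutoff_approaches s u U (fun x => 1 - chi x) (fun q x => csub (U x) (F q x)) s0 uH FT.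
move=> /(_ (smooth_onem chi sc) _ _ _ FU r r0 roo).
case=> [x x2|x||H1 H2].
- by rewrite c0// subrr.
- by have := c01 x; lra.
- by rewrite chi0 subr0.
split.
  apply: cvg_trans H1; apply: near_eq_cvg; apply: nearW => n.
  by rewrite -normWN; apply: eq_normW => x /=; ring.
apply: cvg_trans H2; apply: near_eq_cvg; apply: nearW => n.
by rewrite -normWN; apply: eq_normW => x /=; ring.
Qed.

Lemma L2_cst0 : L2 (fun=> (0, 0) : R * R).
Proof.
split => //; split => //=.
rewrite (_ : (fun _ => _) = cst 0%E); first exact: integrable0.
by apply/funext => x; rewrite /cnorm2/= expr0n/= addr0.
Qed.

Lemma normW_cst0 s : normW s (fun=> 0 : R) = 0%E.
Proof.
rewrite /normW (eq_intR _ (fun=> 0)) => [|x]; last by rewrite expr0n/= mulr0.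
by rewrite /intR integral0.
Qed.

Lemma pairing0 (m : R -> R) (W : R -> R * R) : pairing m (fun=> (0, 0)) W = (0, 0).
Proof.
have z (f : R -> R) : (forall x, f x = 0) -> \int[mu]_x f x = 0.
  move=> f0; rewrite /Rintegral; under eq_integral do rewrite f0.
  by rewrite integral0.
by congr pair; apply: z => x /=; ring.
Qed.

End commutator_limit.

Theorem mainTheorem3 (R : realType) (s : R) (m : R -> R)
  (u : R -> R * R) (U : R -> R * R) (phi psi : R -> R)
  (Fphi Gphi Fpsi Gpsi : R -> R -> R * R) :
  assumptionA s m ->
  in_H s u -> is_FT u U ->
  smooth phi -> smooth psi ->
  (forall x, 0 <= phi x <= 1) -> (forall x, 0 <= psi x <= 1) ->
  (forall x, `|x| < 1 -> phi x = 1) -> (forall x, 2 < `|x| -> phi x = 0) ->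
  (forall x, `|x| < 1 -> psi x = 0) -> (forall x, 2 < `|x| -> psi x = 1) ->
  (* Fphi r = FT of phi_r u,  Gphi r = FT of phi_r^2 u, same for psi *)
  (forall r, 0 < r -> is_FT (rmulf (fun x => phi (x / r)) u) (Fphi r)) ->
  (forall r, 0 < r -> is_FT (rmulf (fun x => phi (x / r) ^+ 2) u) (Gphi r)) ->
  (forall r, 0 < r -> is_FT (rmulf (fun x => psi (x / r)) u) (Fpsi r)) ->
  (forall r, 0 < r -> is_FT (rmulf (fun x => psi (x / r) ^+ 2) u) (Gpsi r)) ->
  let Qphi := fun r => csub (pairing m (Fphi r) (Fphi r)) (pairing m (Gphi r) U) in
  let Qpsi := fun r => csub (pairing m (Fpsi r) (Fpsi r)) (pairing m (Gpsi r) U) in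
  ((Qphi r).1 @[r --> +oo] --> 0) /\ ((Qphi r).2 @[r --> +oo] --> 0) /\
  ((Qpsi r).1 @[r --> +oo] --> 0) /\ ((Qpsi r).2 @[r --> +oo] --> 0).
Proof.
move=> hA uH FT sphi spsi p01 q01 p1 p2 q1 q2 FF FG SF SG Qphi Qpsi.
have s0 : 0 < s by case: hA.
have [LU _] := FT.
have [U1 U2] := in_H_normW s u U s0 uH FT.
have n0 : `|0 : R| < 1 by rewrite normr0.
have sqr01 (f : R -> R) : (forall x, 0 <= f x <= 1) -> forall x, 0 <= f x ^+ 2 <= 1.
  by move=> f01 x; have [? ?] := andP (f01 x); rewrite sqr_ge0 exprn_ile1.
have [phi1 phi2] : ((Qphi r).1 @[r --> +oo] --> (0 : R)) /\ ((Qphi r).2 @[r --> +oo] --> (0 : R)).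
  apply: (commutator_cvg s m U U Fphi Gphi) => //.
  - by move=> r r0; have [] := FF r r0.
  - by move=> r r0; have [] := FG r r0.
  - by apply: (cutoff_approaches s u U phi) => //; exact: p1.
  - apply: (cutoff_approaches s u U (fun x => phi x ^+ 2)) => //.
    + exact: smooth_sqr.
    + by move=> x /p2 ->; rewrite expr0n.
    + exact: sqr01.
    + by rewrite p1// expr1n.
have [psi1 psi2] : ((Qpsi r).1 @[r --> +oo] --> (0 : R)) /\ ((Qpsi r).2 @[r --> +oo] --> (0 : R)).
  apply: (commutator_cvg s m U (fun=> (0, 0)) Fpsi Gpsi) => //.
  - exact: L2_cst0.
  - by rewrite normW_cst0.
  - by rewrite normW_cst0.
  - by move=> r r0; have [] := SF r r0.
  - by move=> r r0; have [] := SG r r0.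
  - by apply: (cocutoff_approaches s u U psi) => //; exact: q1.
  - apply: (cocutoff_approaches s u U (fun x => psi x ^+ 2)) => //.
    + exact: smooth_sqr.
    + by move=> x /q2 ->; rewrite expr1n.
    + exact: sqr01.
    + by rewrite q1// expr0n.
  - by rewrite !pairing0.
by [].
Qed.
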